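(* Let $\Omega\subset\mathbb{S}^2$ be a rotationally symmetric domain of the standard sphere, let $\varepsilon\in\{1,-1\}$, $q>0$, $q\ne1$, and consider in $\Omega$ the equation $$\Delta_{\mathbb{S}^2}u=\varepsilon u|u|^{q-1}.\qquad (E)$$ i) If $\varepsilon=+1$ or $q\neq3$, then any pseudo-radial solution of (E) is radial. ii) The equation $\Delta_{\mathbb{S}^2}u=-u^3$ admits infinitely many non-radial pseudo-radial solutions in $\Omega$, which are all, up to rotation in $\theta$, of the form $$u_k=\pm\frac{w_k(\theta)}{\sin r},$$ where, for any integer $k\ge2$, $w_k$ is the unique (up to sign and translation) nonconstant solution with least period $\frac{2\pi}{k}$ of the ODE $w''+w=-w^3$.
   Context: $\Delta_{\mathbb{S}^2}$ is the Laplace-Beltrami operator of the standard sphere. A rotationally symmetric domain $\Omega$ is identified, via geodesic polar coordinates $(r,\theta)$ around its center, with $I\times\mathbb{S}^1$, $I\subset(0,\pi)$ an open interval, endowed with the metric $dr^2+\sin^2 r\,d\theta^2$ (so solutions may be singular at the center). Solutions are real-valued classical solutions on $I\times\mathbb{S}^1$. A solution $u$ is pseudo-radial if $u(r,\theta)=h(r)w(\theta)$ for some function $h$ on $I$ and some $2\pi$-periodic function $w$; it is radial if it does not depend on $\theta$, and non-radial otherwise. *)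

(* Defs.v *)
From Stdlib Require Import Reals.
From Coquelicot Require Import Coquelicot.
Open Scope R_scope.

(* Throughout, the rotationally symmetric domain is ]a, b[ x S^1 with
   0 <= a < b <= PI, in geodesic polar coordinates (r, theta).  A function on it
   is a map u : R -> R -> R, written u r theta, that is 2*PI-periodic in theta;
   its values for r outside ]a, b[ are irrelevant. *)

Definition periodic (T : R) (f : R -> R) : Prop :=
  forall x, f (x + T) = f x.

(* Laplace-Beltrami operator in the coordinates (r, theta):
     |g|^(-1/2) * sum_ij d_i (|g|^(1/2) g^ij d_j u)
   for the metric g = dr^2 + sin^2 r dtheta^2, where |g|^(1/2) = sin r,
   g^rr = 1 and g^(theta theta) = 1 / sin^2 r. *)
Definition laplace_beltrami_S2 (u : R -> R -> R) (r theta : R) : R :=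
  / sin r *
  (Derive (fun s => sin s * Derive (fun t => u t theta) s) r +
   Derive (fun s => sin r * (/ (sin r) ^ 2 * Derive (fun t => u r t) s)) theta).

(* Real-valued solution, of class C^2 on ]a, b[ x S^1, of Delta u = F u.
   As ]a, b[ x R is open, [ex_diff_n u 2] at all of its points is exactly C^2. *)
Definition classical_solution (a b : R) (F : R -> R) (u : R -> R -> R) : Prop :=
  (forall r, a < r < b -> periodic (2 * PI) (u r)) /\
  (forall r theta, a < r < b ->
     ex_diff_n u 2 r theta /\ laplace_beltrami_S2 u r theta = F (u r theta)).

(* s |s|^(q-1) for q > 0.  At s = 0 this is 0, also when q < 1, because Rpower
   is total and the factor s vanishes. *)
Definition signed_power (q s : R) : R := s * Rpower (Rabs s) (q - 1).

Definition pseudo_radial (a b : R) (u : R -> R -> R) : Prop :=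
  exists h w : R -> R, periodic (2 * PI) w /\
    forall r theta, a < r < b -> u r theta = h r * w theta.

Definition radial (a b : R) (u : R -> R -> R) : Prop :=
  forall r theta1 theta2, a < r < b -> u r theta1 = u r theta2.

Definition rotation_of (a b : R) (u v : R -> R -> R) : Prop :=
  exists t, forall r theta, a < r < b -> v r theta = u r (theta + t).

Definition least_period (T : R) (f : R -> R) : Prop :=
  0 < T /\ periodic T f /\ forall T', 0 < T' -> periodic T' f -> T <= T'.

(* Differentiability is required explicitly at both orders because [Derive] is
   a total operator. *)
Definition ode_solution (w : R -> R) : Prop :=
  forall x, ex_derive w x /\ ex_derive (Derive w) x /\
    Derive (Derive w) x + w x = - (w x) ^ 3.

Definition angular_profile (k : nat) (w : R -> R) : Prop :=
  ode_solution w /\ ~ (forall x y, w x = w y) /\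
  least_period (2 * PI / INR k) w.

Definition is_sign (s : R) : Prop := s = 1 \/ s = -1.

(* Main.v *)
Require Import Defs.
From Stdlib Require Import Reals Lra Lia Ranalysis5.
From Stdlib Require Import IndefiniteDescription Classical Compare_dec.
From Coquelicot Require Import Coquelicot.
Open Scope R_scope.

(* For a non-radial u = h w the functions w and w |w|^(q-1) are linearly
   independent, so separating the variables makes sin^2 r |h|^(q-1) constant,
   hence h = c sin^(-p) with p = 2 / (q - 1).  Then
   (sin^2 h'' + sin cos h') / h = p + (p^2 - p) cos^2 must be constant too, which
   forces p = 1, i.e. q = 3, and W = c w solves W'' + W = eps W^3.

   If eps = 1 (soft spring), Sturm comparison with a sine shows that W keeps its
   sign on the half turns on either side of a zero, the signs being opposite, so W
   is not 2 PI-periodic; without zeros, the maximum principle gives |W| = 1.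

   If eps = -1 (hard spring), the substitution w = A sin phi, m = A^2 / 2, turns
   energy conservation into phi' = sqrt (1 + m (1 + sin^2 phi)).  The period
   T(m), an integral over one turn of phi, decreases strictly and continuously
   from 2 PI to 0, so each 2 PI / k with k >= 2 is attained by exactly one
   orbit. *)

(** For the hard spring, [A] is the height of the turning points: energy conservation reads w'^2 =
    (A^2 - w^2) (1 + (A^2 + w^2) / 2). The first factor, which vanishes at the turning points, is
    A^2 cos^2 phi and cancels against the square of the derivative of A sin phi. The period thus
    becomes the integral of a smooth function over the fixed interval [0, 2 PI], and its dependence
    on m is read off by comparing integrands pointwise. The phase is the inverse of the time
    integral, so the solution is global and its orbit fills a whole energy level. By uniqueness for
    the initial value problem, all solutions of that energy are translates of one another; -w is one
    of them.

    In the separation of variables the obstacle is that h might vanish: one may divide by h only off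
    its zeros, and the relation found there has to be carried across them by the continuity of h
    sin^p. The exponents q < 1 and q > 1 are treated alike. *)

Lemma periodic_nat (T : R) (f : R -> R) (n : nat) :
  periodic T f -> periodic (INR n * T) f.
Proof.
intros Hf; induction n as [|n IHn]; intros x.
- f_equal; simpl; ring.
- rewrite S_INR, <- (IHn x), <- (Hf (x + INR n * T)); f_equal; ring.
Qed.

Lemma least_period_unique (T1 T2 : R) (f : R -> R) :
  least_period T1 f -> least_period T2 f -> T1 = T2.
Proof.
intros (H1 & P1 & L1) (H2 & P2 & L2); apply Rle_antisym; auto.
Qed.

(** A nonzero remainder of [P] modulo [T] would be a period smaller than [T]; [n = 0] is excluded by
    [0 < P]. *)
Lemma least_period_divides (T P : R) (f : R -> R) :
  least_period T f -> 0 < P -> periodic P f ->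
  exists n : nat, (1 <= n)%nat /\ P = INR n * T.
Proof.
intros (HT & PT & LT) HP PP.
destruct (nfloor_ex (P / T)) as [n [Hn1 Hn2]].
  apply Rlt_le, Rdiv_lt_0_compat; assumption.
assert (E : P = P / T * T) by (field; lra).
assert (Hle : INR n * T <= P) by (rewrite E; apply Rmult_le_compat_r; lra).
assert (Hlt : P < (INR n + 1) * T)
  by (rewrite E; apply Rmult_lt_compat_r; lra).
destruct (Rle_lt_or_eq_dec _ _ Hle) as [Hl|He].
- exfalso.
  assert (T <= P - INR n * T); [apply LT; [lra|]|lra].
  intros x; rewrite <- (periodic_nat T f n PT (x + (P - INR n * T))), <- (PP x); f_equal; ring.
- exists n; split; [|now symmetry].
  destruct n; [simpl in He; lra|lia].
Qed.

Lemma least_period_shift (T t : R) (f : R -> R) :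
  least_period T f -> least_period T (fun x => f (x + t)).
Proof.
intros (HT & PT & LT); repeat split; auto.
- intros x; rewrite <- (PT (x + t)); f_equal; ring.
- intros T' HT' PT'; apply LT; auto.
  intros x; generalize (PT' (x - t)).
  replace (x - t + T' + t) with (x + T') by ring.
  now replace (x - t + t) with x by ring.
Qed.

Lemma is_derive_increasing_le (f df : R -> R) (x y : R) :
  (forall t, x <= t <= y -> is_derive f t (df t)) ->
  (forall t, x <= t <= y -> 0 <= df t) -> x <= y -> f x <= f y.
Proof.
intros Hf Hdf Hxy.
destruct (MVT_gen f x y df) as (c & Hc & E);
  rewrite ?Rmin_left, ?Rmax_right in * by lra.
- intros t Ht; apply Hf; lra.
- intros t Ht; apply derivable_continuous_pt; exists (df t).
  apply is_derive_Reals, Hf; lra.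
- generalize (Hdf c Hc); nra.
Qed.

Lemma is_derive_zero_const (f : R -> R) :
  (forall t, is_derive f t 0) -> forall x y, f x = f y.
Proof.
intros Hf x y; destruct (Rtotal_order x y) as [H|[H|H]].
- apply eq_is_derive; auto.
- now subst.
- symmetry; apply eq_is_derive; auto.
Qed.

Lemma is_derive_continuity_pt (f : R -> R) (x l : R) :
  is_derive f x l -> continuity_pt f x.
Proof.
intros H; apply derivable_continuous_pt; exists l; now apply is_derive_Reals.
Qed.

Lemma is_derive_inverse (f g : R -> R) (y l : R) :
  (forall x, ex_derive f x) -> (forall z, f (g z) = z) ->
  (forall x1 x2, x1 < x2 -> g x1 <= g x2) ->
  continuity_pt g y -> is_derive f (g y) l -> l <> 0 -> is_derive g y (/ l).
Proof.
intros Hf Hfg Hg Cg Hl Hl0.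
assert (Prf : forall a, g (y - 1) <= a <= g (y + 1) -> derivable_pt f a).
  intros a _; apply ex_derive_Reals_0, Hf.
assert (Hin : g (y - 1) <= g y <= g (y + 1)) by (split; apply Hg; lra).
assert (E : derive_pt f (g y) (Prf (g y) Hin) = l).
  apply derive_pt_eq_0; now apply is_derive_Reals.
apply is_derive_Reals; rewrite <- E; rewrite <- Rdiv_1_l.
apply derivable_pt_lim_recip_interv with (lb := y - 1) (ub := y + 1); try lra.
- exact Cg.
- intros x _; apply Hfg.
Qed.

(** * The cubic ODE: conserved energy and uniqueness *)

Lemma ode_solution_derive (f : R -> R) (x : R) :
  ode_solution f -> is_derive f x (Derive f x).
Proof. intros H; apply Derive_correct, H. Qed.

Lemma ode_solution_derive2 (f : R -> R) (x : R) :
  ode_solution f -> is_derive (Derive f) x (- f x - f x ^ 3).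
Proof.
intros H; destruct (H x) as (_ & H2 & E).
replace (- f x - f x ^ 3) with (Derive (Derive f) x) by lra.
now apply Derive_correct.
Qed.

Lemma ode_solution_intro (f f1 : R -> R) :
  (forall x, is_derive f x (f1 x)) ->
  (forall x, is_derive f1 x (- f x - f x ^ 3)) -> ode_solution f.
Proof.
intros H1 H2 x.
assert (E : forall y, Derive f y = f1 y) by (intros y; now apply is_derive_unique).
assert (H : is_derive (Derive f) x (- f x - f x ^ 3)).
  apply is_derive_ext with f1; auto.
split; [now exists (f1 x)|split; [now exists (- f x - f x ^ 3)|]].
rewrite (is_derive_unique _ _ _ H); ring.
Qed.

Lemma ode_solution_shift (f : R -> R) (t : R) :
  ode_solution f ->
  ode_solution (fun x => f (x + t)) /\
  forall x, Derive (fun x => f (x + t)) x = Derive f (x + t).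
Proof.
intros H.
assert (H1 : forall (g : R -> R) (l x : R), is_derive g (x + t) l -> is_derive (fun y => g (y + t)) x l).
  intros g l x Hg; evar_last.
  - apply (is_derive_comp g (fun y => y + t)); [exact Hg|].
    auto_derive; [exact I|reflexivity].
  - apply Rmult_1_l.
split.
- apply ode_solution_intro with (fun x => Derive f (x + t)); intros x.
  + apply H1, ode_solution_derive, H.
  + apply (H1 (Derive f)), ode_solution_derive2, H.
- intros x; apply is_derive_unique, H1, ode_solution_derive, H.
Qed.

(** Twice the mechanical energy of the spring. At a turning point of height A it equals A^2 + A^4 /
    2, that is 2 m + 2 m^2 with m = A^2 / 2, the level that recurs below. *)
Definition energy (f : R -> R) (x : R) : R :=
  Derive f x ^ 2 + f x ^ 2 + f x ^ 4 / 2.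

Lemma energy_const (f : R -> R) (x y : R) :
  ode_solution f -> energy f x = energy f y.
Proof.
intros H; revert x y; apply is_derive_zero_const; intros t.
unfold energy; evar_last.
- apply (is_derive_plus (V := R_NormedModule) (fun x => Derive f x ^ 2 + f x ^ 2)).
  + apply (is_derive_plus (V := R_NormedModule)).
    * apply (is_derive_pow (Derive f)), ode_solution_derive2, H.
    * apply is_derive_pow, ode_solution_derive, H.
  + apply (is_derive_scal_l (V := R_NormedModule) (fun x => f x ^ 4)).
    apply is_derive_pow, ode_solution_derive, H.
- unfold plus, scal; simpl; unfold mult; simpl; field.
Qed.

Lemma energy_bound (f : R -> R) (x : R) : f x ^ 2 <= energy f x.
Proof. unfold energy; nra. Qed.

(** The cubic is only locally Lipschitz. The common initial data give both solutions the same energy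
    [E], which bounds f^2 and g^2 at all times; hence f^2 + f g + g^2, the difference quotient of
    the cubes, stays in [0, 3 E] and one Gronwall constant serves on the whole line. *)
Lemma ode_solution_unique (f g : R -> R) (x0 : R) :
  ode_solution f -> ode_solution g ->
  f x0 = g x0 -> Derive f x0 = Derive g x0 -> forall x, f x = g x.
Proof.
intros Hf Hg E0 E1.
set (E := energy f x0).
assert (Bf : forall x, f x ^ 2 <= E).
  intros x; unfold E; rewrite (energy_const f x0 x Hf); apply energy_bound.
assert (Bg : forall x, g x ^ 2 <= E).
  intros x; replace E with (energy g x); [apply energy_bound|].
  rewrite (energy_const g x x0 Hg); unfold E, energy; now rewrite E0, E1.
(* Gronwall for the squared distance [N] in the phase plane: |N'| <= 3 E N *)
set (N := fun x => (f x - g x) ^ 2 + (Derive f x - Derive g x) ^ 2).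
set (dN := fun x => - 2 * (f x - g x) * (Derive f x - Derive g x) *
   (f x ^ 2 + f x * g x + g x ^ 2)).
assert (HN : forall x, is_derive N x (dN x)).
  intros x; unfold N, dN; evar_last.
  - apply (is_derive_plus (V := R_NormedModule)
      (fun x => (f x - g x) ^ 2) (fun x => (Derive f x - Derive g x) ^ 2)).
    + apply (is_derive_pow (fun x => f x - g x)).
      apply (is_derive_minus (V := R_NormedModule)); apply ode_solution_derive; assumption.
    + apply (is_derive_pow (fun x => Derive f x - Derive g x)).
      apply (is_derive_minus (V := R_NormedModule)); apply ode_solution_derive2; assumption.
  - unfold plus, minus, opp; simpl; unfold plus; simpl; ring.
assert (HNb : forall x, - (3 * E * N x) <= dN x <= 3 * E * N x).
  intros x; apply Rabs_le_between; unfold N, dN.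
  set (d := f x - g x); set (d' := Derive f x - Derive g x).
  set (Q := f x ^ 2 + f x * g x + g x ^ 2).
  assert (HQ : 0 <= Q <= 3 * E).
    unfold Q; generalize (Bf x) (Bg x) (pow2_ge_0 (f x + g x)) (pow2_ge_0 (f x - g x))
      (pow2_ge_0 (f x)) (pow2_ge_0 (g x)); split; lra.
  assert (Hd : Rabs (-2 * d * d') <= d ^ 2 + d' ^ 2) by
    (apply Rabs_le; generalize (pow2_ge_0 (d + d')) (pow2_ge_0 (d - d')); split; lra).
  rewrite Rabs_mult, (Rabs_right Q), Rmult_comm by lra.
  apply Rmult_le_compat; try lra; apply Rabs_pos.
assert (N0 : N x0 = 0) by (unfold N; rewrite E0, E1; ring).
assert (Hexp : forall c x, is_derive (fun x => N x * exp (c * x)) x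
                (dN x * exp (c * x) + c * N x * exp (c * x))).
  intros c x; evar_last.
  - apply (is_derive_mult N (fun x => exp (c * x))); [apply HN| |intros; apply Rmult_comm].
    apply (is_derive_comp exp (fun x => c * x)); [apply is_derive_Reals, derivable_pt_lim_exp|].
    auto_derive; [exact I|reflexivity].
  - unfold plus, mult, scal; simpl; unfold mult; simpl; ring.
(* The weight exp (- 3 E x) makes [N] nonincreasing, which settles the right of [x0]; the weight exp
   (3 E x) makes it nondecreasing, which settles the left. *)
assert (HN0 : forall x, N x <= 0).
  intros x; destruct (Rle_dec x0 x) as [Hx|Hx].
  - assert (H : - (N x0 * exp (- (3 * E) * x0)) <= - (N x * exp (- (3 * E) * x))).
      apply (is_derive_increasing_le (fun x => - (N x * exp (- (3 * E) * x)))
        (fun x => - (dN x * exp (- (3 * E) * x) + - (3 * E) * N x * exp (- (3 * E) * x)))); [| |lra].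
      + intros t _; apply (is_derive_opp (V := R_NormedModule)
          (fun x => N x * exp (- (3 * E) * x))), Hexp.
      + intros t _; generalize (HNb t) (exp_pos (- (3 * E) * t)); nra.
    rewrite N0 in H; generalize (exp_pos (- (3 * E) * x)); nra.
  - assert (H : N x * exp (3 * E * x) <= N x0 * exp (3 * E * x0)).
      apply (is_derive_increasing_le (fun x => N x * exp (3 * E * x)) _ x x0
        (fun t _ => Hexp (3 * E) t)); [|lra].
      intros t _; generalize (HNb t) (exp_pos (3 * E * t)); nra.
    rewrite N0 in H; generalize (exp_pos (3 * E * x)); nra.
intros x; specialize (HN0 x); unfold N in HN0.
apply Rminus_diag_uniq, Rsqr_0_uniq; rewrite Rsqr_pow2.
generalize (pow2_ge_0 (f x - g x)) (pow2_ge_0 (Derive f x - Derive g x)); lra.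
Qed.

(** * The hard spring *)

Definition speed (m phi : R) : R := sqrt (1 + m * (1 + sin phi ^ 2)).

Lemma speed_arg_bounds (m phi : R) : 0 <= m ->
  1 + m <= 1 + m * (1 + sin phi ^ 2) <= 1 + 2 * m.
Proof.
intros Hm; assert (0 <= sin phi ^ 2 <= 1); [|nra].
generalize (SIN_bound phi); split; nra.
Qed.

Lemma speed_bounds (m phi : R) : 0 <= m ->
  sqrt (1 + m) <= speed m phi <= sqrt (1 + 2 * m).
Proof.
intros Hm; generalize (speed_arg_bounds m phi Hm); intros H.
split; apply sqrt_le_1_alt; lra.
Qed.

Lemma speed_ge_1 (m phi : R) : 0 <= m -> 1 <= speed m phi.
Proof.
intros Hm; rewrite <- sqrt_1; apply Rle_trans with (sqrt (1 + m)).
- apply sqrt_le_1_alt; lra.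
- now apply speed_bounds.
Qed.

Lemma speed_sq (m phi : R) : 0 <= m ->
  speed m phi ^ 2 = 1 + m * (1 + sin phi ^ 2).
Proof.
intros Hm; apply pow2_sqrt.
generalize (speed_arg_bounds m phi Hm); lra.
Qed.

Lemma speed_derive (m phi : R) : 0 <= m ->
  is_derive (speed m) phi (m * sin phi * cos phi / speed m phi).
Proof.
intros Hm; generalize (speed_arg_bounds m phi Hm) (speed_ge_1 m phi Hm); intros H1 H2.
unfold speed in *; auto_derive; simpl in *; [lra|field; lra].
Qed.

Lemma continuous_inv_speed (m phi : R) : 0 <= m ->
  continuous (fun s => / speed m s) phi.
Proof.
intros Hm; apply (ex_derive_continuous (V := R_NormedModule)).
generalize (speed_derive m phi Hm) (speed_ge_1 m phi Hm); intros H1 H2.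
apply ex_derive_inv; [eexists; exact H1|lra].
Qed.

Lemma ex_RInt_inv_speed (m x y : R) : 0 <= m ->
  ex_RInt (fun s => / speed m s) x y.
Proof.
intros Hm; apply (ex_RInt_continuous (V := R_CompleteNormedModule)).
intros z _; now apply continuous_inv_speed.
Qed.

(** The time at which the phase, started from angle 0, reaches the angle [phi]. *)
Definition time (m phi : R) : R := RInt (fun s => / speed m s) 0 phi.

Definition period (m : R) : R := time m (2 * PI).

Lemma time_derive (m phi : R) : 0 <= m -> is_derive (time m) phi (/ speed m phi).
Proof.
intros Hm; apply (is_derive_RInt (V := R_CompleteNormedModule) (fun s => / speed m s) _ 0);
  [|now apply continuous_inv_speed].
exists (mkposreal 1 Rlt_0_1); intros y _.
apply (RInt_correct (V := R_CompleteNormedModule)); now apply ex_RInt_inv_speed.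
Qed.

(** The slope of [time m] is at least 1 / sqrt (1 + 2 m). This single bound yields the surjectivity
    and injectivity of [time m] and the Lipschitz continuity of its inverse. *)
Lemma time_expand (m x y : R) : 0 <= m -> x <= y ->
  (y - x) / sqrt (1 + 2 * m) <= time m y - time m x.
Proof.
intros Hm Hxy; set (c := / sqrt (1 + 2 * m)).
assert (H : time m x - c * x <= time m y - c * y).
  apply (is_derive_increasing_le (fun t => time m t - c * t) (fun t => / speed m t - c));
    [| |exact Hxy].
  - intros t _; apply (is_derive_minus (V := R_NormedModule)); [now apply time_derive|].
    auto_derive; [exact I|ring].
  - intros t _; generalize (speed_bounds m t Hm) (speed_ge_1 m t Hm); intros H1 H2.
    assert (/ sqrt (1 + 2 * m) <= / speed m t) by (apply Rinv_le_contravar; lra).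
    unfold c; lra.
unfold Rdiv; fold c; lra.
Qed.

Lemma time_add_turn (m phi : R) : 0 <= m ->
  time m (phi + 2 * PI) = time m phi + period m.
Proof.
intros Hm.
assert (H : time m (phi + 2 * PI) - time m phi = time m (0 + 2 * PI) - time m 0).
  apply (is_derive_zero_const (fun s => time m (s + 2 * PI) - time m s)).
  intros t; evar_last.
  - apply (is_derive_minus (V := R_NormedModule) (fun s => time m (s + 2 * PI)));
      [|now apply time_derive].
    apply (is_derive_comp (time m) (fun s => s + 2 * PI)); [now apply time_derive|].
    auto_derive; [exact I|reflexivity].
  - unfold speed; rewrite sin_plus, sin_2PI, cos_2PI.
    unfold minus, plus, opp, scal; simpl; unfold mult; simpl.
    replace (sin t * 1 + cos t * 0) with (sin t) by ring; ring.
rewrite Rplus_0_l in H.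
assert (H0 : time m 0 = 0) by apply (RInt_point (V := R_CompleteNormedModule)).
unfold period; lra.
Qed.

(** The equation phi' = [speed m] phi is autonomous, so it is solved by inverting [time m]. The
    inverse, obtained by choice, is monotone and Lipschitz by [time_expand], which is the continuity
    that the inverse function rule asks for. *)
Lemma phase_exists (m : R) : 0 <= m -> exists phi : R -> R,
  (forall x, time m (phi x) = x) /\ (forall s, phi (time m s) = s) /\
  (forall x, is_derive phi x (speed m (phi x))) /\
  (forall x, phi (x + period m) = phi x + 2 * PI).
Proof.
intros Hm.
set (C := sqrt (1 + 2 * m)).
assert (HC : 0 < C) by (apply sqrt_lt_R0; lra).
assert (T0 : time m 0 = 0) by apply (RInt_point (V := R_CompleteNormedModule)).
assert (Hcont : continuity (time m)).
  intros x; apply (is_derive_continuity_pt _ _ (/ speed m x)); now apply time_derive.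
assert (Hex : forall x, exists s, time m s = x).
  intros x.
  (* By [time_expand], [time m] is at least |x| at [A] and at most -|x| at [- A], so the
     intermediate value theorem applies on this interval. *)
  set (A := C * Rabs x); assert (HA : 0 <= A) by (generalize (Rabs_pos x); unfold A; nra).
  assert (E : A / C = Rabs x) by (unfold A; field; lra).
  generalize (time_expand m 0 A Hm HA) (time_expand m (- A) 0 Hm ltac:(lra)).
  fold C; rewrite T0.
  replace ((A - 0) / C) with (Rabs x) by (rewrite <- E; field; lra).
  replace ((0 - - A) / C) with (Rabs x) by (rewrite <- E; field; lra).
  intros H1 H2.
  destruct (IVT_gen (time m) (- A) A x Hcont) as [s [_ Hs]]; [|now exists s].
  generalize (Rabs_le_between x (Rabs x)) (Rle_refl (Rabs x)); intros [H3 _] H4.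
  specialize (H3 H4).
  rewrite Rmin_left, Rmax_right by lra; lra.
destruct (functional_choice _ Hex) as [phi Hphi]; exists phi.
assert (Hinj : forall s t, time m s = time m t -> s = t).
  assert (Hlt : forall s t, s < t -> time m s < time m t).
    intros s t Hst; generalize (time_expand m s t Hm ltac:(lra)).
    assert (0 < (t - s) / sqrt (1 + 2 * m)) by (apply Rdiv_lt_0_compat; fold C; lra).
    lra.
  intros s t E; destruct (Rtotal_order s t) as [H|[H|H]]; auto;
    apply Hlt in H; lra.
assert (Hinc : forall x y, x < y -> phi x <= phi y /\ phi y - phi x <= C * (y - x)).
  intros x y Hxy.
  assert (H : phi x <= phi y).
    apply Rnot_lt_le; intros H.
    generalize (time_expand m (phi y) (phi x) Hm ltac:(lra)); rewrite !Hphi.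
    assert (0 < (phi x - phi y) / sqrt (1 + 2 * m)) by (apply Rdiv_lt_0_compat; fold C; lra).
    lra.
  split; [exact H|].
  generalize (time_expand m (phi x) (phi y) Hm H); rewrite !Hphi; fold C; intros H1.
  apply Rmult_le_compat_l with (r := C) in H1; [|lra].
  replace (C * ((phi y - phi x) / C)) with (phi y - phi x) in H1 by (field; lra).
  exact H1.
split; [exact Hphi|split; [intros s; apply Hinj, Hphi|split]].
- intros x; rewrite <- (Rinv_inv (speed m (phi x))).
  generalize (speed_ge_1 m (phi x) Hm); intros Hs.
  apply (is_derive_inverse (time m)).
  + intros s; eexists; now apply time_derive.
  + exact Hphi.
  + intros s t Hst; now apply Hinc.
  + intros e He; exists (e / C); split; [now apply Rdiv_lt_0_compat|].
    unfold dist, D_x, no_cond; simpl; unfold R_dist; intros y [_ Hy].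
    apply Rle_lt_trans with (C * Rabs (y - x)).
    * destruct (Rtotal_order x y) as [H|[H|H]].
      -- generalize (Hinc x y H); intros H'.
         rewrite !Rabs_right by lra; lra.
      -- subst; rewrite !Rminus_diag, Rabs_R0; lra.
      -- generalize (Hinc y x H); intros H'.
         rewrite !Rabs_left1 by lra; lra.
    * apply Rmult_lt_compat_l with (r := C) in Hy; [|lra].
      now replace (C * (e / C)) with e in Hy by (field; lra).
  + now apply time_derive.
  + apply Rinv_neq_0_compat; lra.
- intros x; apply Hinj; rewrite Hphi, time_add_turn, Hphi by assumption; ring.
Qed.

(** * Dependence of the period on the amplitude *)

Lemma period_decreasing (m n : R) : 0 <= m -> m < n -> period n < period m.
Proof.
intros Hm Hmn; generalize PI_RGT_0; intros Hpi.
apply RInt_lt; [lra| | |].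
- intros x _; apply continuous_inv_speed; lra.
- intros x _; apply continuous_inv_speed; lra.
- intros x _; apply Rinv_lt_contravar.
  + generalize (speed_ge_1 m x Hm) (speed_ge_1 n x ltac:(lra)); nra.
  + apply sqrt_lt_1_alt; generalize (speed_arg_bounds m x Hm) (pow2_ge_0 (sin x)); nra.
Qed.

Lemma period_0 : period 0 = 2 * PI.
Proof.
unfold period, time.
rewrite (RInt_ext (V := R_CompleteNormedModule) _ (fun _ => 1)).
- rewrite (RInt_const (V := R_CompleteNormedModule)); unfold scal; simpl; unfold mult; simpl; ring.
- intros x _; unfold speed; rewrite Rmult_0_l, Rplus_0_r, sqrt_1; apply Rinv_1.
Qed.

Lemma period_pos (m : R) : 0 <= m -> 0 < period m.
Proof.
intros Hm; generalize PI_RGT_0; intros Hpi.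
generalize (time_expand m 0 (2 * PI) Hm ltac:(lra)); fold (period m).
replace (time m 0) with 0 by (symmetry; apply (RInt_point (V := R_CompleteNormedModule))).
assert (0 < (2 * PI - 0) / sqrt (1 + 2 * m)); [|lra].
apply Rdiv_lt_0_compat; [lra|apply sqrt_lt_R0; lra].
Qed.

Lemma period_le (m : R) : 0 <= m -> period m <= 2 * PI / sqrt (1 + m).
Proof.
intros Hm; generalize PI_RGT_0; intros Hpi.
assert (H : Rabs (period m) <= (2 * PI - 0) * / sqrt (1 + m)).
  apply abs_RInt_le_const; [lra|now apply ex_RInt_inv_speed|].
  intros t _; generalize (speed_bounds m t Hm) (speed_ge_1 m t Hm); intros H1 H2.
  rewrite Rabs_right by (apply Rle_ge, Rlt_le, Rinv_0_lt_compat; lra).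
  apply Rinv_le_contravar; [apply sqrt_lt_R0|]; lra.
generalize (Rle_abs (period m)); unfold Rdiv; lra.
Qed.

Lemma period_lipschitz (m n : R) : 0 <= m -> 0 <= n ->
  Rabs (period m - period n) <= 2 * PI * Rabs (m - n).
Proof.
intros Hm Hn; generalize PI_RGT_0; intros Hpi.
assert (E : period m - period n = RInt (fun s => / speed m s - / speed n s) 0 (2 * PI)).
  symmetry; apply (RInt_minus (V := R_CompleteNormedModule)); now apply ex_RInt_inv_speed.
rewrite E; replace (2 * PI * Rabs (m - n)) with ((2 * PI - 0) * Rabs (m - n)) by ring.
apply abs_RInt_le_const; [lra| |].
- apply (ex_RInt_minus (V := R_NormedModule)); now apply ex_RInt_inv_speed.
- intros t _.
  generalize (speed_ge_1 m t Hm) (speed_ge_1 n t Hn) (speed_sq m t Hm) (speed_sq n t Hn)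
    (speed_arg_bounds 1 t ltac:(lra)).
  set (p := speed m t); set (q := speed n t); set (s := sin t ^ 2); intros Hp Hq Ep Eq Hs.
  (* Rationalizing gives (q^2 - p^2) / ((p + q) p q) with q^2 - p^2 = (n - m) (1 + s). Since p, q >=
     1, and s <= 1 by [speed_arg_bounds] at parameter 1, the second factor is at most 1. *)
  replace (/ p - / q) with ((n - m) * ((1 + s) / ((p + q) * (p * q)))).
    2:{ replace ((n - m) * ((1 + s) / ((p + q) * (p * q))))
          with ((n * (1 + s) - m * (1 + s)) / ((p + q) * (p * q))) by (field; nra).
        replace (n * (1 + s) - m * (1 + s)) with ((q - p) * (q + p)) by lra.
        field; nra. }
  rewrite Rabs_mult, (Rabs_minus_sym n m).
  rewrite <- (Rmult_1_r (Rabs (m - n))) at 2.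
  apply Rmult_le_compat_l; [apply Rabs_pos|].
  assert (1 <= p * q) by nra.
  assert (2 <= (p + q) * (p * q)) by nra.
  rewrite Rabs_right by (apply Rle_ge, Rlt_le, Rdiv_lt_0_compat; lra).
  apply Rle_div_l; lra.
Qed.

Lemma period_surjective (T : R) : 0 < T < 2 * PI -> exists m, 0 < m /\ period m = T.
Proof.
intros HT; generalize PI_RGT_0; intros Hpi.
(* Chosen so that 2 PI / sqrt M = T; the upper bound 2 PI / sqrt (1 + M) on [period M] is then
   strictly below [T]. *)
set (M := (2 * PI / T) ^ 2).
assert (HR : 1 < 2 * PI / T) by (apply Rlt_div_r; lra).
assert (HM : 1 < M) by (unfold M; nra).
assert (HTM : period M < T).
  apply Rle_lt_trans with (2 * PI / sqrt (1 + M)); [apply period_le; lra|].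
  assert (2 * PI / T < sqrt (1 + M)).
    rewrite <- (sqrt_pow2 (2 * PI / T)) by lra; fold M; apply sqrt_lt_1_alt; lra.
  apply Rlt_div_l; [lra|].
  replace (2 * PI) with (T * (2 * PI / T)) by (field; lra); nra.
(* [Rabs] extends [period] continuously to negative arguments *)
destruct (IVT_interv (fun m => T - period (Rabs m)) 0 M) as [m [Hm Em]].
- intros m _ e He; exists (e / (2 * PI)); split; [apply Rdiv_lt_0_compat; lra|].
  unfold dist, D_x, no_cond; simpl; unfold R_dist; intros y [_ Hy].
  replace (T - period (Rabs y) - (T - period (Rabs m)))
    with (- (period (Rabs y) - period (Rabs m))) by ring.
  rewrite Rabs_Ropp.
  apply Rle_lt_trans with (2 * PI * Rabs (y - m)).
  + eapply Rle_trans; [apply period_lipschitz; apply Rabs_pos|].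
    apply Rmult_le_compat_l; [lra|apply Rabs_triang_inv2].
  + apply Rlt_div_r in Hy; lra.
- lra.
- rewrite Rabs_R0, period_0; lra.
- rewrite Rabs_right; lra.
- rewrite Rabs_right in Em by lra.
  exists m; split; [|lra].
  destruct (proj1 Hm) as [H|H]; [exact H|].
  rewrite <- H, period_0 in Em; lra.
Qed.

Lemma period_injective (m n : R) : 0 < m -> 0 < n -> period m = period n -> m = n.
Proof.
intros Hm Hn E; destruct (Rtotal_order m n) as [H|[H|H]]; auto;
  apply period_decreasing in H; lra.
Qed.

Lemma period_lt_2PI (m : R) : 0 < m -> period m < 2 * PI.
Proof. intros Hm; rewrite <- period_0; apply period_decreasing; lra. Qed.

(** * Orbits in the phase plane *)

Lemma sin_cos_pos_inv (x : R) : 0 < x -> sin x = 0 -> 0 < cos x -> 2 * PI <= x.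
Proof.
intros Hx Hs Hc; generalize PI_RGT_0; intros Hpi.
apply Rnot_lt_le; intros H.
destruct (Rtotal_order x PI) as [H1|[H1|H1]].
- generalize (sin_gt_0 x Hx H1); lra.
- subst; rewrite cos_PI in Hc; lra.
- generalize (sin_lt_0 x H1 H); lra.
Qed.

(** The energy level is parametrized by the angle. Once c0 = A sin s, the energy fixes only c1^2;
    taking for [s] the arcsine or its supplement adjusts the sign of [c1]. *)
Lemma phase_point (m c0 c1 : R) : 0 < m ->
  c1 ^ 2 + c0 ^ 2 + c0 ^ 4 / 2 = 2 * m + 2 * m ^ 2 ->
  exists s, c0 = sqrt (2 * m) * sin s /\ c1 = sqrt (2 * m) * cos s * speed m s.
Proof.
intros Hm E; set (A := sqrt (2 * m)).
assert (HA : 0 < A) by (apply sqrt_lt_R0; lra).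
assert (HA2 : A ^ 2 = 2 * m) by (apply pow2_sqrt; lra).
(* The second factor is positive, so this factorization also shows |c0| <= A, as [asin] requires. *)
assert (E' : c1 ^ 2 = (2 * m - c0 ^ 2) * (1 + m + c0 ^ 2 / 2)).
  replace ((2 * m - c0 ^ 2) * (1 + m + c0 ^ 2 / 2))
    with (2 * m + 2 * m ^ 2 - c0 ^ 2 - c0 ^ 4 / 2) by field; lra.
assert (Hc0 : c0 ^ 2 <= A ^ 2).
  rewrite HA2; generalize (pow2_ge_0 c0) (pow2_ge_0 c1); nra.
assert (Hr : -1 <= c0 / A <= 1).
  assert (- A <= c0 <= A) by (split; nra).
  split; [apply Rle_div_r|apply Rle_div_l]; lra.
assert (Hsp : forall s, sin s = c0 / A ->
    (A * cos s * speed m s) ^ 2 = c1 ^ 2).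
  intros s Hs; rewrite E'.
  replace ((A * cos s * speed m s) ^ 2)
    with (A ^ 2 * (cos s ^ 2) * speed m s ^ 2) by ring.
  rewrite speed_sq by lra.
  replace (cos s ^ 2) with (1 - sin s ^ 2)
    by (generalize (sin2_cos2 s); unfold Rsqr; lra).
  rewrite Hs, HA2; replace ((c0 / A) ^ 2) with (c0 ^ 2 / (2 * m))
    by (rewrite <- HA2; field; lra).
  field; lra.
set (s := asin (c0 / A)).
assert (Hs : sin s = c0 / A) by now apply sin_asin.
assert (Hcos : 0 <= cos s) by (apply cos_ge_0; generalize (asin_bound (c0 / A)); unfold s; lra).
assert (Hspd : 0 < speed m s) by (generalize (speed_ge_1 m s ltac:(lra)); lra).
assert (Hpos : 0 <= A * cos s * speed m s)
  by (apply Rmult_le_pos; [apply Rmult_le_pos|]; lra).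
generalize (Hsp s Hs); intros Hsq.
destruct (Rle_dec 0 c1) as [H1|H1].
- exists s; split; [rewrite Hs; field; lra|].
  nra.
- assert (Hs' : sin (PI - s) = sin s) by apply sin_PI_x.
  exists (PI - s); split; [rewrite Hs', Hs; field; lra|].
  replace (speed m (PI - s)) with (speed m s) by (unfold speed; now rewrite Hs').
  replace (cos (PI - s)) with (- cos s)
    by (rewrite cos_minus, cos_PI, sin_PI; ring).
  nra.
Qed.

(** The last clause says that the orbit covers its whole energy level; with [ode_solution_unique] it
    makes every solution of that energy a translate of [w]. *)
Lemma orbit_exists (m : R) : 0 < m -> exists w : R -> R,
  ode_solution w /\ least_period (period m) w /\
  (forall c0 c1, c1 ^ 2 + c0 ^ 2 + c0 ^ 4 / 2 = 2 * m + 2 * m ^ 2 ->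
     exists t, w t = c0 /\ Derive w t = c1).
Proof.
intros Hm.
destruct (phase_exists m) as (phi & H1 & H2 & H3 & H4); [lra|].
set (A := sqrt (2 * m)).
assert (HA : 0 < A) by (apply sqrt_lt_R0; lra).
assert (HA2 : A ^ 2 = 2 * m) by (apply pow2_sqrt; lra).
set (w := fun x => A * sin (phi x)).
set (w1 := fun x => A * cos (phi x) * speed m (phi x)).
assert (Dw : forall x, is_derive w x (w1 x)).
  intros x; unfold w, w1; evar_last.
  - apply (is_derive_scal (fun x => sin (phi x))).
    apply (is_derive_comp sin phi); [apply is_derive_Reals, derivable_pt_lim_sin|apply H3].
  - unfold scal; simpl; unfold mult; simpl; ring.
assert (Dw1 : forall x, is_derive w1 x (- w x - w x ^ 3)).
  intros x; unfold w1, w; evar_last.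
  - apply (is_derive_comp (fun s => A * cos s * speed m s) phi); [|apply H3].
    apply (is_derive_mult (fun s => A * cos s) (speed m));
      [auto_derive; [exact I|reflexivity]|apply speed_derive; lra|intros; apply Rmult_comm].
  - unfold scal, plus; simpl; unfold mult; simpl.
    generalize (speed_ge_1 m (phi x)) (speed_sq m (phi x)) (sin2_cos2 (phi x)).
    unfold Rsqr; set (p := speed m (phi x)); set (s := sin (phi x)); set (c := cos (phi x)).
    intros P1 P2 P3; specialize (P1 ltac:(lra)); specialize (P2 ltac:(lra)).
    replace (p * (A * (1 * - s) * p + A * c * (m * s * c / p)))
      with (A * s * (m * (c * c) - p ^ 2)) by (field; lra).
    rewrite P2; replace (c * c) with (1 - s * s) by lra.
    replace ((A * s) * ((A * s) * ((A * s) * 1))) with (A * s * (A ^ 2) * s ^ 2) by ring.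
    rewrite HA2; ring.
assert (Ow : ode_solution w) by now apply ode_solution_intro with w1.
assert (EDw : forall x, Derive w x = w1 x) by (intros x; now apply is_derive_unique).
assert (Phi0 : phi 0 = 0).
  rewrite <- (H2 0) at 2; f_equal; symmetry.
  apply (RInt_point (V := R_CompleteNormedModule)).
exists w; split; [exact Ow|split].
- split; [apply period_pos; lra|split].
  + intros x; unfold w; rewrite H4, sin_plus, cos_2PI, sin_2PI; ring.
  + intros T' HT' PT'.
    (* A period [T'] brings back the state at time 0, where w = 0 and w' > 0. So sin vanishes and
       cos is positive at phi T' > 0; the phase has made a full turn, which takes at least
       [period m]. *)
    assert (E0 : w T' = 0).
      rewrite <- (Rplus_0_l T'), PT'; unfold w; rewrite Phi0, sin_0; ring.
    assert (E1 : w1 T' = w1 0).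
      rewrite <- !EDw.
      transitivity (Derive (fun x => w (x + T')) 0).
      * rewrite (proj2 (ode_solution_shift w T' Ow)); f_equal; ring.
      * now apply Derive_ext.
    assert (Hspd : forall x, 0 < speed m x) by (intros x; generalize (speed_ge_1 m x ltac:(lra)); lra).
    assert (Hw1 : 0 < w1 0).
      unfold w1; rewrite Phi0, cos_0; apply Rmult_lt_0_compat; [lra|apply Hspd].
    assert (Hmono : forall s t, s <= t -> time m s <= time m t).
      intros s t Hst; generalize (time_expand m s t ltac:(lra) Hst).
      assert (0 <= (t - s) / sqrt (1 + 2 * m)); [|lra].
      apply Rle_div_r; [apply sqrt_lt_R0; lra|lra].
    rewrite <- (H1 T'); apply Hmono; apply sin_cos_pos_inv.
    * apply Rnot_le_lt; intros Hle; apply Hmono in Hle.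
      rewrite H1, <- Phi0, H1 in Hle; lra.
    * unfold w in E0; apply Rmult_integral in E0; destruct E0; lra.
    * rewrite <- E1 in Hw1; unfold w1 in Hw1; generalize (Hspd (phi T')).
      intros Hp; apply Rnot_le_lt; intros Hle.
      assert (0 <= - (A * cos (phi T')) * speed m (phi T'))
        by (apply Rmult_le_pos; nra).
      lra.
- intros c0 c1 E; destruct (phase_point m c0 c1 Hm E) as (s & Es0 & Es1).
  exists (time m s); rewrite EDw; unfold w, w1; rewrite H2; now split.
Qed.

(** [m] depends on [f] alone, before any [w] is given: the result can be used once with an auxiliary
    orbit, to find the period of [f], and again with the reference profile of that period. *)
Lemma ode_solution_orbit (f : R -> R) :
  ode_solution f -> ~ (forall x y, f x = f y) -> exists m, 0 < m /\
  forall w, ode_solution w ->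
    (forall c0 c1, c1 ^ 2 + c0 ^ 2 + c0 ^ 4 / 2 = 2 * m + 2 * m ^ 2 ->
       exists t, w t = c0 /\ Derive w t = c1) ->
    exists t, forall x, f x = w (x + t).
Proof.
intros Hf Hn.
set (E := energy f 0).
assert (HE : 0 < E).
  apply Rnot_le_lt; intros H; apply Hn.
  assert (H0 : forall x, f x = 0).
    intros x; generalize (energy_bound f x) (pow2_ge_0 (f x)).
    rewrite (energy_const f x 0 Hf); fold E; intros H1 H2.
    apply Rsqr_0_uniq; rewrite Rsqr_pow2; lra.
  intros x y; now rewrite !H0.
set (r := sqrt (1 + 2 * E)).
assert (Hr : r ^ 2 = 1 + 2 * E) by (apply pow2_sqrt; lra).
assert (Hr1 : 1 < r) by (rewrite <- sqrt_1; apply sqrt_lt_1_alt; lra).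
(* The positive root of 2 m + 2 m^2 = E, since (2 m + 1)^2 = 1 + 2 E. *)
exists ((r - 1) / 2); split; [lra|].
intros w Hw Horb.
destruct (Horb (f 0) (Derive f 0)) as (t & E0 & E1).
  change (E = 2 * ((r - 1) / 2) + 2 * ((r - 1) / 2) ^ 2); field_simplify; rewrite Hr; field.
exists t; destruct (ode_solution_shift w t Hw) as [Hs Ds].
apply (ode_solution_unique f (fun x => w (x + t)) 0 Hf Hs).
- now rewrite Rplus_0_l.
- now rewrite Ds, Rplus_0_l.
Qed.

(** * The soft spring *)

Lemma is_derive_pos_near (f : R -> R) (x l : R) :
  is_derive f x l -> 0 < l -> exists d, 0 < d /\
  (forall t, x < t < x + d -> f x < f t) /\ (forall t, x - d < t < x -> f t < f x).
Proof.
intros Hf Hl; apply is_derive_Reals in Hf.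
destruct (Hf (l / 2)) as [d Hd]; [lra|].
assert (H : forall t, t <> x -> Rabs (t - x) < d -> 0 < (f t - f x) / (t - x)).
  intros t Ht Htd; generalize (Hd (t - x) ltac:(lra) Htd).
  replace (x + (t - x)) with t by ring.
  intros H; apply Rabs_lt_between in H; lra.
exists d; split; [apply cond_pos|split]; intros t Ht.
- generalize (H t ltac:(lra) ltac:(rewrite Rabs_right; lra)); intros H1.
  assert (0 < (f t - f x) / (t - x) * (t - x)) by (apply Rmult_lt_0_compat; lra).
  replace ((f t - f x) / (t - x) * (t - x)) with (f t - f x) in H0 by (field; lra); lra.
- generalize (H t ltac:(lra) ltac:(rewrite Rabs_left; lra)); intros H1.
  assert (0 < (f t - f x) / (t - x) * (x - t)) by (apply Rmult_lt_0_compat; lra).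
  replace ((f t - f x) / (t - x) * (x - t)) with (- (f t - f x)) in H0 by (field; lra); lra.
Qed.

(** The zero is the supremum of the times up to which [f] stays positive: by continuity, a positive
    value there would let the positivity continue further, and a negative one would contradict it
    just before. *)
Lemma first_zero (f : R -> R) (c y : R) : continuity f -> c < y -> 0 < f c -> f y <= 0 ->
  exists x, c < x <= y /\ f x = 0 /\ forall t, c <= t < x -> 0 < f t.
Proof.
intros Hf Hcy Hc Hy.
assert (Hnear : forall x, f x <> 0 -> exists d, 0 < d /\
    forall t, Rabs (t - x) < d -> 0 < f x * f t).
  intros x Hx; destruct (Hf x (Rabs (f x))) as [d [Hd H]]; [now apply Rabs_pos_lt|].
  exists d; split; [exact Hd|]; intros t Ht.
  destruct (Req_dec t x) as [->|Hn]; [generalize (Rlt_0_sqr _ Hx); unfold Rsqr; lra|].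
  specialize (H t); unfold dist, D_x, no_cond in H; simpl in H; unfold R_dist in H.
  specialize (H (conj (conj I (not_eq_sym Hn)) Ht)).
  revert H; unfold Rabs; destruct (Rcase_abs (f t - f x)), (Rcase_abs (f x)); intros; nra.
set (S := fun t => c <= t <= y /\ forall s, c <= s <= t -> 0 < f s).
destruct (completeness S) as [x [Hub Hlub]].
- exists y; intros t [Ht _]; lra.
- exists c; split; [lra|]; intros s Hs; now replace s with c by lra.
- assert (Hcx : c <= x) by (apply Hub; split; [lra|]; intros s Hs; now replace s with c by lra).
  assert (Hxy : x <= y) by (apply Hlub; intros t [Ht _]; lra).
  assert (Hlt : forall t, c <= t < x -> 0 < f t).
    intros t Ht; apply NNPP; intros Hn.
    assert (x <= t); [|lra].
    apply Hlub; intros s [Hs1 Hs2]; apply Rnot_lt_le; intros Hts; apply Hn, Hs2; lra.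
  destruct (Req_dec (f x) 0) as [H0|H0].
  + exists x; split; [|now split]; split; [|exact Hxy].
    destruct Hcx as [H|H]; [exact H|subst; lra].
  + exfalso; destruct (Hnear x H0) as [d [Hd H]].
    destruct (Rtotal_order (f x) 0) as [Hsg|[Hsg|Hsg]]; [|contradiction|].
    * assert (Hcx' : c < x) by (destruct Hcx as [H1|H1]; [exact H1|subst; lra]).
      set (t := Rmax c (x - d / 2)).
      assert (Ht : c <= t < x /\ x - d / 2 <= t).
        unfold t; generalize (Rmax_l c (x - d / 2)) (Rmax_r c (x - d / 2)).
        split; [split; [lra|apply Rmax_lub_lt; lra]|lra].
      specialize (H t ltac:(rewrite Rabs_left; lra)); specialize (Hlt t (proj1 Ht)); nra.
    * assert (Hxy' : x < y) by (destruct Hxy as [H1|H1]; [exact H1|subst; lra]).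
      set (t := Rmin y (x + d / 2)).
      assert (Ht : x < t <= y /\ t <= x + d / 2).
        unfold t; generalize (Rmin_l y (x + d / 2)) (Rmin_r y (x + d / 2)).
        split; [split; [apply Rmin_glb_lt; lra|lra]|lra].
      assert (t <= x); [|lra].
      apply Hub; split; [lra|]; intros s Hs.
      destruct (Rlt_dec s x) as [Hsx|Hsx]; [apply Hlt; lra|].
      specialize (H s ltac:(rewrite Rabs_right; lra)); nra.
Qed.

Lemma max_second_derivative (f f1 : R -> R) (p l : R) :
  (forall x, is_derive f x (f1 x)) -> is_derive f1 p l ->
  (forall x, f x <= f p) -> l <= 0.
Proof.
intros Hf Hf1 Hmax.
assert (H1 : f1 p = 0).
  destruct (Rtotal_order (f1 p) 0) as [H|[H|H]]; [exfalso|exact H|exfalso].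
  - destruct (is_derive_pos_near (fun x => - f x) p (- f1 p)) as (d & Hd & _ & H2).
    + apply (is_derive_opp (V := R_NormedModule)), Hf.
    + lra.
    + specialize (H2 (p - d / 2) ltac:(lra)); generalize (Hmax (p - d / 2)); lra.
  - destruct (is_derive_pos_near f p (f1 p) (Hf p) H) as (d & Hd & H2 & _).
    specialize (H2 (p + d / 2) ltac:(lra)); generalize (Hmax (p + d / 2)); lra.
apply Rnot_lt_le; intros Hl.
destruct (is_derive_pos_near f1 p l Hf1 Hl) as (d & Hd & H2 & _).
destruct (MVT_cor2 f f1 p (p + d / 2)) as (c & Hc1 & Hc2); [lra| |].
- intros c _; apply is_derive_Reals, Hf.
- specialize (H2 c ltac:(lra)); generalize (Hmax (p + d / 2)); nra.
Qed.

Lemma periodic_reduce (T : R) (f : R -> R) (x : R) :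
  0 < T -> periodic T f -> exists y, 0 <= y <= T /\ f x = f y.
Proof.
intros HT Hf.
destruct (nfloor_ex (Rabs x / T)) as [n [_ Hn]].
  apply Rdiv_le_0_compat; [apply Rabs_pos|exact HT].
(* Enough periods are added to make the point nonnegative, so that [nfloor_ex] applies to
   [z / T]. *)
set (z := x + INR (S n) * T).
assert (Hz : 0 <= z).
  unfold z; rewrite S_INR; apply Rlt_div_l in Hn; [|exact HT].
  generalize (Rle_abs (- x)); rewrite Rabs_Ropp; lra.
destruct (nfloor_ex (z / T)) as [k [Hk1 Hk2]]; [now apply Rdiv_le_0_compat|].
apply Rle_div_r in Hk1; [|exact HT]; apply Rlt_div_l in Hk2; [|exact HT].
exists (z - INR k * T); split; [lra|].
rewrite <- (periodic_nat T f (S n) Hf x), <- (periodic_nat T f k Hf (z - INR k * T)).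
unfold z; f_equal; ring.
Qed.

Lemma periodic_max (T : R) (f : R -> R) :
  0 < T -> periodic T f -> continuity f -> exists p, forall x, f x <= f p.
Proof.
intros HT Hf Cf.
destruct (continuity_ab_maj f 0 T) as [p [Hp _]]; [lra|intros; apply Cf|].
exists p; intros x; destruct (periodic_reduce T f x HT Hf) as [y [Hy ->]]; now apply Hp.
Qed.

Definition soft_solution (f f1 : R -> R) : Prop :=
  (forall x, is_derive f x (f1 x)) /\ (forall x, is_derive f1 x (f x ^ 3 - f x)).

Lemma soft_continuity (f f1 : R -> R) : soft_solution f f1 -> continuity f.
Proof. intros [H _] x; eapply is_derive_continuity_pt, H. Qed.

Lemma soft_opp (f f1 : R -> R) :
  soft_solution f f1 -> soft_solution (fun x => - f x) (fun x => - f1 x).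
Proof.
intros [H1 H2]; split; intros x.
- apply (is_derive_opp (V := R_NormedModule)), H1.
- evar_last; [apply (is_derive_opp (V := R_NormedModule)), H2|].
  unfold opp; simpl; ring.
Qed.

(** The odd reflection preserves the slope at a zero, so that the comparison to the right of a
    rising zero also controls the half turn to its left. *)
Lemma soft_reflect (f f1 : R -> R) :
  soft_solution f f1 -> soft_solution (fun x => - f (- x)) (fun x => f1 (- x)).
Proof.
assert (Hr : forall (g : R -> R) (l x : R), is_derive g (- x) l ->
    is_derive (fun y => g (- y)) x (- l)).
  intros g l x Hg; evar_last.
  - apply (is_derive_comp g (fun y => - y)); [exact Hg|].
    auto_derive; [exact I|reflexivity].
  - unfold scal; simpl; unfold mult; simpl; ring.
intros [H1 H2]; split; intros x.
- evar_last; [apply (is_derive_opp (V := R_NormedModule) (fun y => f (- y))), Hr, H1|].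
  apply Ropp_involutive.
- evar_last; [apply Hr, H2|simpl; ring].
Qed.

(* Sturm comparison with [sin (x - x0)]: the Wronskian has derivative f^3 sin *)
Lemma soft_pos_half_turn (f f1 : R -> R) (x0 y : R) :
  soft_solution f f1 -> f x0 = 0 -> 0 < f1 x0 -> x0 < y <= x0 + PI -> 0 < f y.
Proof.
intros Hs H0 H1 Hy; generalize Hs; intros [D1 D2].
apply Rnot_le_lt; intros Hle.
destruct (is_derive_pos_near f x0 _ (D1 x0) H1) as (d & Hd & Hr & _).
rewrite H0 in Hr.
set (c := Rmin (x0 + d / 2) ((x0 + y) / 2)).
assert (Hc : x0 < c /\ c < y /\ c < x0 + d).
  unfold c; generalize (Rmin_l (x0 + d / 2) ((x0 + y) / 2)) (Rmin_r (x0 + d / 2) ((x0 + y) / 2)).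
  repeat split; try lra; apply Rmin_glb_lt; lra.
destruct (first_zero f c y) as (x1 & Hx1 & Z1 & Hpos); try lra.
  now apply soft_continuity with f1.
  apply Hr; lra.
set (V := fun t => f1 t * sin (t - x0) - f t * cos (t - x0)).
assert (DV : forall t, is_derive V t (f t ^ 3 * sin (t - x0))).
  intros t; unfold V; evar_last.
  - apply (is_derive_minus (V := R_NormedModule)
      (fun t => f1 t * sin (t - x0)) (fun t => f t * cos (t - x0))).
    + apply (is_derive_mult f1 (fun t => sin (t - x0))); [apply D2| |intros; apply Rmult_comm].
      auto_derive; [exact I|reflexivity].
    + apply (is_derive_mult f (fun t => cos (t - x0))); [apply D1| |intros; apply Rmult_comm].
      auto_derive; [exact I|reflexivity].
  - unfold minus, plus, opp; simpl; unfold mult; simpl; unfold Rminus; ring.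
destruct (MVT_cor2 V (fun t => f t ^ 3 * sin (t - x0)) x0 x1) as (t & Et & Ht); [lra| |].
  intros t _; apply is_derive_Reals, DV.
assert (Hft : 0 < f t).
  destruct (Rlt_dec t (x0 + d)); [apply Hr; lra|apply Hpos; lra].
assert (Hst : 0 < sin (t - x0)) by (apply sin_gt_0; lra).
(* At the zero [x1], V x1 = f1 x1 sin (x1 - x0). Its positivity forces f1 x1 > 0 (and rules out x1 =
   x0 + PI), although [f] reaches 0 there from positive values. *)
assert (HV : 0 < V x1).
  assert (V x0 = 0) by (unfold V; rewrite H0, Rminus_diag, sin_0; ring).
  assert (0 < f t ^ 3 * sin (t - x0) * (x1 - x0)).
    apply Rmult_lt_0_compat; [apply Rmult_lt_0_compat; [now apply pow_lt|exact Hst]|lra].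
  lra.
unfold V in HV; rewrite Z1 in HV.
assert (0 <= sin (x1 - x0)) by (apply sin_ge_0; lra).
assert (Hf1 : 0 < f1 x1) by nra.
destruct (is_derive_pos_near f x1 _ (D1 x1) Hf1) as (d' & Hd' & _ & Hl).
set (s := Rmax c (x1 - d' / 2)).
assert (Hs' : c <= s < x1 /\ x1 - d' / 2 <= s).
  unfold s; generalize (Rmax_l c (x1 - d' / 2)) (Rmax_r c (x1 - d' / 2)).
  split; [split; [lra|apply Rmax_lub_lt; lra]|lra].
specialize (Hl s ltac:(lra)); specialize (Hpos s ltac:(lra)); lra.
Qed.

(** After a rising zero, f (x0 + PI) > 0; by reflection, f (x0 - PI) < 0. The two points differ by
    exactly one period. *)
Lemma soft_zero_slope_nonpos (f f1 : R -> R) (x0 : R) :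
  soft_solution f f1 -> periodic (2 * PI) f -> f x0 = 0 -> f1 x0 <= 0.
Proof.
intros Hs Hp H0; apply Rnot_lt_le; intros H1; generalize PI_RGT_0; intros Hpi.
generalize (soft_pos_half_turn f f1 x0 (x0 + PI) Hs H0 H1 ltac:(lra)).
generalize (soft_pos_half_turn _ _ (- x0) (- x0 + PI) (soft_reflect f f1 Hs)).
rewrite Ropp_involutive, H0; intros H2; specialize (H2 ltac:(lra) H1 ltac:(lra)).
rewrite <- (Hp (- (- x0 + PI))) in H2.
replace (- (- x0 + PI) + 2 * PI) with (x0 + PI) in H2 by ring; lra.
Qed.

(** The energy is zero, so f^2 <= f^4 / 2 and each value has f^2 = 0 or f^2 >= 2. By continuity f^2
    cannot jump this gap; the value 1 is the witness. *)
Lemma soft_double_zero (f f1 : R -> R) (x0 : R) :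
  soft_solution f f1 -> f x0 = 0 -> f1 x0 = 0 -> forall x, f x = 0.
Proof.
intros Hs H0 H1.
assert (HE : forall x, f1 x ^ 2 + f x ^ 2 - f x ^ 4 / 2 = 0).
  intros x; transitivity (f1 x0 ^ 2 + f x0 ^ 2 - f x0 ^ 4 / 2); [|rewrite H0, H1; field].
  apply (is_derive_zero_const (fun x => f1 x ^ 2 + f x ^ 2 - f x ^ 4 / 2)); intros t.
  evar_last.
  - apply (is_derive_minus (V := R_NormedModule) (fun x => f1 x ^ 2 + f x ^ 2)).
    + apply (is_derive_plus (V := R_NormedModule)); apply is_derive_pow; apply Hs.
    + apply (is_derive_scal_l (V := R_NormedModule) (fun x => f x ^ 4)), is_derive_pow, Hs.
  - unfold minus, opp, plus, scal; simpl; unfold mult; simpl; field.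
intros x; apply NNPP; intros Hx.
assert (Hx2 : 0 < f x ^ 2) by (apply pow2_gt_0, Hx).
assert (Hbig : 2 <= f x ^ 2).
  generalize (HE x) (pow2_ge_0 (f1 x)).
  replace (f x ^ 4) with (f x ^ 2 * f x ^ 2) by ring; intros H2 H3.
  apply Rnot_lt_le; intros H4.
  assert (f x ^ 2 * f x ^ 2 < f x ^ 2 * 2) by (apply Rmult_lt_compat_l; lra); lra.
destruct (IVT_gen (fun y => f y ^ 2) x0 x 1) as (z & _ & Hz).
- intros y; apply (continuity_pt_comp f (fun s => s ^ 2)).
  + now apply soft_continuity with f1.
  + apply derivable_continuous_pt, derivable_pt_pow.
- rewrite H0, Rmin_left, Rmax_right by lra; lra.
- generalize (HE z) (pow2_ge_0 (f1 z)).
  replace (f z ^ 4) with ((f z ^ 2) ^ 2) by ring; rewrite Hz; lra.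
Qed.

Lemma soft_pos_const (f f1 : R -> R) :
  soft_solution f f1 -> periodic (2 * PI) f -> (forall x, 0 < f x) -> forall x, f x = 1.
Proof.
intros Hs Hp Hpos; generalize PI_RGT_0; intros Hpi.
assert (Hp' : periodic (2 * PI) (fun x => - f x)) by (intros x; now rewrite Hp).
destruct (periodic_max (2 * PI) f) as [p Hmax]; [lra|exact Hp|now apply soft_continuity with f1|].
destruct (periodic_max (2 * PI) (fun x => - f x)) as [q Hmin];
  [lra|exact Hp'|eapply soft_continuity, soft_opp, Hs|].
generalize (max_second_derivative f f1 p _ (proj1 Hs) (proj2 Hs p) Hmax).
destruct (soft_opp f f1 Hs) as [Hs1 Hs2].
generalize (max_second_derivative _ _ q _ Hs1 (Hs2 q) Hmin).
intros H1 H2 x; generalize (Hpos p) (Hpos q) (Hmax x) (Hmin x); intros.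
replace ((f p) ^ 3 - f p) with (f p * (f p - 1) * (f p + 1)) in H2 by ring.
replace ((- f q) ^ 3 - - f q) with (f q * (1 - f q) * (f q + 1)) in H1 by ring.
assert (f p <= 1).
  apply Rnot_lt_le; intros Hc.
  assert (0 < f p * (f p - 1) * (f p + 1)) by (repeat apply Rmult_lt_0_compat; lra); lra.
assert (1 <= f q).
  apply Rnot_lt_le; intros Hc.
  assert (0 < f q * (1 - f q) * (f q + 1)) by (repeat apply Rmult_lt_0_compat; lra); lra.
lra.
Qed.

Lemma soft_periodic_const (f f1 : R -> R) :
  soft_solution f f1 -> periodic (2 * PI) f -> forall x y, f x = f y.
Proof.
intros Hs Hp.
destruct (classic (exists x0, f x0 = 0)) as [[x0 H0]|Hn].
- assert (H1 : f1 x0 = 0).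
    apply Rle_antisym; [now apply (soft_zero_slope_nonpos f f1)|].
    assert (Hp' : periodic (2 * PI) (fun x => - f x)) by (intros x; now rewrite Hp).
    generalize (soft_zero_slope_nonpos _ _ x0 (soft_opp f f1 Hs) Hp'); rewrite H0; lra.
  intros x y; now rewrite !(soft_double_zero f f1 x0).
- assert (Hsign : (forall x, 0 < f x) \/ (forall x, 0 < - f x)).
    destruct (Rtotal_order (f 0) 0) as [H|[H|H]].
    + right; intros x; apply Rnot_le_lt; intros Hx; apply Hn.
      destruct (IVT_gen f 0 x 0) as (z & _ & Hz);
        [now apply soft_continuity with f1|rewrite Rmin_left, Rmax_right; lra|now exists z].
    + exfalso; apply Hn; now exists 0.
    + left; intros x; apply Rnot_le_lt; intros Hx; apply Hn.
      destruct (IVT_gen f 0 x 0) as (z & _ & Hz);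
        [now apply soft_continuity with f1|rewrite Rmin_right, Rmax_left; lra|now exists z].
  destruct Hsign as [H|H]; intros x y.
  + now rewrite !(soft_pos_const f f1 Hs Hp H).
  + assert (Hp' : periodic (2 * PI) (fun x => - f x)) by (intros z; now rewrite Hp).
    generalize (soft_pos_const _ _ (soft_opp f f1 Hs) Hp' H x)
      (soft_pos_const _ _ (soft_opp f f1 Hs) Hp' H y); lra.
Qed.

(** * Separation of variables *)

Lemma locally_between (a b r : R) : a < r < b -> locally r (fun t => a < t < b).
Proof.
intros H; apply (open_and (fun t => a < t) (fun t => t < b));
  [apply open_gt|apply open_lt|exact H].
Qed.

Lemma sin_pos_between (a b r : R) : 0 <= a -> b <= PI -> a < r < b -> 0 < sin r.
Proof. intros; apply sin_gt_0; lra. Qed.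

Lemma laplace_beltrami_product (a b : R) (u : R -> R -> R) (h h1 w w1 : R -> R)
    (h2 w2 r theta : R) :
  0 <= a -> b <= PI -> a < r < b ->
  (forall s t, a < s < b -> u s t = h s * w t) ->
  (forall s, a < s < b -> is_derive h s (h1 s)) -> is_derive h1 r h2 ->
  (forall t, is_derive w t (w1 t)) -> is_derive w1 theta w2 ->
  laplace_beltrami_S2 u r theta =
    h2 * w theta + cos r / sin r * h1 r * w theta + h r * w2 / sin r ^ 2.
Proof.
intros Ha Hb Hr Hu Hh Hh1 Hw Hw1.
assert (Hs : 0 < sin r) by now apply (sin_pos_between a b).
assert (E1 : Derive (fun s => sin s * Derive (fun t => u t theta) s) r
             = cos r * (h1 r * w theta) + sin r * (h2 * w theta)).
  rewrite (Derive_ext_loc _ (fun s => sin s * (h1 s * w theta))).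
  - apply is_derive_unique; evar_last.
    + apply (is_derive_mult sin (fun s => h1 s * w theta));
        [apply is_derive_Reals, derivable_pt_lim_sin| |intros; apply Rmult_comm].
      apply (is_derive_scal_l (V := R_NormedModule)), Hh1.
    + reflexivity.
  - generalize (locally_between a b r Hr); apply filter_imp; intros s Hs'; f_equal.
    rewrite (Derive_ext_loc _ (fun t => h t * w theta)).
    + apply is_derive_unique, (is_derive_scal_l (V := R_NormedModule)), Hh, Hs'.
    + generalize (locally_between a b s Hs'); apply filter_imp; intros t Ht; now apply Hu.
assert (E2 : Derive (fun s => sin r * (/ sin r ^ 2 * Derive (fun t => u r t) s)) theta
             = sin r * (/ sin r ^ 2 * (h r * w2))).
  rewrite (Derive_ext _ (fun s => sin r * (/ sin r ^ 2 * (h r * w1 s)))).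
  - rewrite 2!Derive_scal.
    rewrite (is_derive_unique _ _ _ (is_derive_scal w1 theta (h r) w2 Hw1)); reflexivity.
  - intros s; do 2 f_equal.
    rewrite (Derive_ext _ (fun t => h r * w t)) by (intros t; now apply Hu).
    apply is_derive_unique, is_derive_scal, Hw.
unfold laplace_beltrami_S2; rewrite E1, E2; field; lra.
Qed.

(** [pseudo_radial] asks no regularity of [h] and [w]. Each is recovered as a multiple of a section
    of the C^2 function [u], frozen at a point where the other factor is nonzero. *)
Lemma product_derivatives (a b : R) (F : R -> R) (u : R -> R -> R) (h w : R -> R)
    (r0 theta0 : R) :
  classical_solution a b F u -> a < r0 < b ->
  (forall r t, a < r < b -> u r t = h r * w t) -> h r0 <> 0 -> w theta0 <> 0 ->
  (forall r, a < r < b -> ex_derive h r /\ ex_derive (Derive h) r) /\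
  (forall t, ex_derive w t /\ ex_derive (Derive w) t).
Proof.
intros [_ Hsol] Hr0 Hu Hh0 Hw0.
assert (Eh : forall r, a < r < b -> locally r (fun s => / w theta0 * u s theta0 = h s)).
  intros r Hr; generalize (locally_between a b r Hr); apply filter_imp; intros s Hs.
  rewrite Hu by exact Hs; field; exact Hw0.
assert (Ew : forall t, / h r0 * u r0 t = w t) by (intros t; rewrite Hu by exact Hr0; now field).
split.
- intros r Hr; destruct (Hsol r theta0 Hr) as [(_ & D1 & _ & (_ & D2 & _) & _) _]; split.
  + apply ex_derive_ext_loc with (1 := Eh r Hr), ex_derive_scal, D1.
  + apply ex_derive_ext_loc with (fun s => / w theta0 * Derive (fun z => u z theta0) s).
    * generalize (locally_between a b r Hr); apply filter_imp; intros s Hs.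
      rewrite <- Derive_scal; apply Derive_ext_loc, Eh, Hs.
    * apply ex_derive_scal, D2.
- intros t; destruct (Hsol r0 t Hr0) as [(_ & _ & D1 & _ & (_ & _ & D2 & _)) _]; split.
  + apply ex_derive_ext with (1 := Ew), ex_derive_scal, D1.
  + apply ex_derive_ext with (fun s => / h r0 * Derive (fun z => u r0 z) s).
    * intros s; rewrite <- Derive_scal; now apply Derive_ext.
    * apply ex_derive_scal, D2.
Qed.

Lemma Rpower_inj_base (x y e : R) :
  0 < x -> 0 < y -> e <> 0 -> Rpower x e = Rpower y e -> x = y.
Proof.
intros Hx Hy He E; apply exp_inv in E; apply ln_inv; auto.
now apply Rmult_eq_reg_l in E.
Qed.

Lemma signed_power_mult (q x y : R) :
  signed_power q (x * y) = signed_power q x * signed_power q y.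
Proof.
unfold signed_power.
destruct (Req_dec x 0) as [->|Hx]; [ring|]; destruct (Req_dec y 0) as [->|Hy]; [ring|].
rewrite Rabs_mult, <- Rpower_mult_distr by now apply Rabs_pos_lt.
ring.
Qed.

Lemma signed_power_3 (s : R) : signed_power 3 s = s ^ 3.
Proof.
unfold signed_power; destruct (Req_dec s 0) as [->|Hs]; [ring|].
replace (3 - 1) with (INR 2) by (simpl; ring).
rewrite Rpower_pow, pow2_abs by now apply Rabs_pos_lt.
ring.
Qed.

(** Two nonzero values of different moduli are what makes w and w |w|^(q-1) linearly independent;
    two distinct values alone could be opposite. *)
Lemma two_moduli (w : R -> R) : continuity w -> ~ (forall x y, w x = w y) ->
  exists x y, 0 < Rabs (w x) < Rabs (w y).
Proof.
intros Hc Hn.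
assert (H : exists x y, w x <> w y /\ Rabs (w x) <= Rabs (w y)).
  apply NNPP; intros H; apply Hn; intros x y; apply NNPP; intros Hxy.
  apply H; destruct (Rle_dec (Rabs (w x)) (Rabs (w y))).
  - now exists x, y.
  - exists y, x; split; [congruence|lra].
destruct H as (x & y & Hxy & Hle).
(* Three quarters of the way towards the value of larger modulus: the midpoint would be 0 if the two
   values were opposite. *)
destruct (IVT_gen w y x ((3 * w y + w x) / 4) Hc) as (z & _ & Hz).
  unfold Rmin, Rmax; destruct (Rle_dec (w y) (w x)); lra.
exists z, y; rewrite Hz; revert Hle; unfold Rabs.
destruct (Rcase_abs (w x)), (Rcase_abs (w y)), (Rcase_abs ((3 * w y + w x) / 4)); lra.
Qed.

(** The level [g r0 / 2] separates [g r0] from the other possible values 0 and [- g r0], and a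
    continuous [g] cannot cross it. *)
Lemma two_valued_const (a b : R) (g : R -> R) (r0 r : R) :
  (forall s, a < s < b -> continuity_pt g s) ->
  (forall s, a < s < b -> g s = 0 \/ Rabs (g s) = Rabs (g r0)) ->
  a < r0 < b -> a < r < b -> g r0 <> 0 -> g r = g r0.
Proof.
intros Hc Hv Hr0 Hr H0.
assert (Hg : 0 < g r0 * g r0) by now apply Rsqr_pos_lt in H0.
assert (Hv' : forall s, a < s < b -> g s = 0 \/ g s = g r0 \/ g s = - g r0).
  intros s Hs; destruct (Hv s Hs) as [H|H]; [now left|].
  revert H; unfold Rabs; destruct (Rcase_abs (g s)), (Rcase_abs (g r0)); lra.
set (f := fun s => g s * g r0 - g r0 * g r0 / 2).
assert (Hf : forall s, a < s < b -> f s <> 0).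
  intros s Hs; unfold f; destruct (Hv' s Hs) as [->|[->| ->]]; lra.
assert (Cf : forall s, a < s < b -> continuity_pt f s).
  intros s Hs; apply continuity_pt_minus; [apply continuity_pt_mult|]; auto;
    apply continuity_pt_const; intros ? ?; reflexivity.
assert (F0 : 0 < f r0) by (unfold f; lra).
apply NNPP; intros Hne.
assert (F1 : f r < 0) by (unfold f; destruct (Hv' r Hr) as [->|[H| ->]]; [lra|contradiction|lra]).
destruct (Rtotal_order r r0) as [H|[H|H]].
- destruct (IVT_interv f r r0) as (z & Hz & Ez); auto.
  + intros s Hs; apply Cf; lra.
  + apply (Hf z); [lra|exact Ez].
- subst; lra.
- destruct (IVT_interv (fun s => - f s) r0 r) as (z & Hz & Ez); try lra.
  + intros s Hs; apply continuity_pt_opp, Cf; lra.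
  + apply (Hf z); lra.
Qed.

Lemma sin_power_derive (e r : R) : 0 < sin r ->
  is_derive (fun s => Rpower (sin s) e) r (e * (cos r / sin r) * Rpower (sin r) e).
Proof.
intros Hs; unfold Rpower; auto_derive; [exact Hs|field; lra].
Qed.

Lemma cos_sqr_not_const (a b k c : R) : 0 <= a -> a < b -> b <= PI ->
  (forall r s, a < r < b -> a < s < b -> k * cos r ^ 2 + c = k * cos s ^ 2 + c) -> k = 0.
Proof.
intros Ha Hab Hb H.
(* Two points could be symmetric about PI / 2; three distinct cosines cannot all have the same
   square. *)
set (r1 := a + (b - a) / 4); set (r2 := a + (b - a) / 2); set (r3 := b - (b - a) / 4).
assert (C12 : cos r2 < cos r1) by (unfold r1, r2; apply cos_decreasing_1; lra).
assert (C23 : cos r3 < cos r2) by (unfold r2, r3; apply cos_decreasing_1; lra).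
generalize (H r1 r2 ltac:(unfold r1; lra) ltac:(unfold r2; lra)).
generalize (H r1 r3 ltac:(unfold r1; lra) ltac:(unfold r3; lra)).
intros E13 E12; apply NNPP; intros Hk.
assert (cos r1 ^ 2 = cos r2 ^ 2) by (apply (Rmult_eq_reg_l k); [lra|exact Hk]).
assert (cos r1 ^ 2 = cos r3 ^ 2) by (apply (Rmult_eq_reg_l k); [lra|exact Hk]).
assert ((cos r1 - cos r2) * (cos r1 + cos r2) = 0) by lra.
assert ((cos r1 - cos r3) * (cos r1 + cos r3) = 0) by lra.
assert (cos r1 + cos r2 = 0) by nra.
assert (cos r1 + cos r3 = 0) by nra.
lra.
Qed.

(** [W] is the angular factor scaled by the constant c of h = c / sin r, which absorbs c^2 so that
    the cubic term has coefficient exactly [eps]. Both parts of the theorem start from this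
    reduction. *)
Lemma pseudo_radial_profile (a b eps q : R) (u : R -> R -> R) :
  0 <= a -> a < b -> b <= PI -> eps <> 0 -> q <> 1 ->
  classical_solution a b (fun s => eps * signed_power q s) u ->
  pseudo_radial a b u -> ~ radial a b u ->
  q = 3 /\ exists W W1 : R -> R,
    (forall x, is_derive W x (W1 x)) /\
    (forall x, is_derive W1 x (eps * W x ^ 3 - W x)) /\
    periodic (2 * PI) W /\ ~ (forall x y, W x = W y) /\
    (forall r t, a < r < b -> u r t = W t / sin r).
Proof.
intros Ha Hab Hb Heps Hq Hsol (h & w & Hper & Hu) Hnr.
assert (Hex : exists r0 t1 t2, a < r0 < b /\ u r0 t1 <> u r0 t2).
  apply NNPP; intros H; apply Hnr; intros r t1 t2 Hr; apply NNPP; intros Hne.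
  apply H; now exists r, t1, t2.
destruct Hex as (r0 & t1 & t2 & Hr0 & Hne).
rewrite !Hu in Hne by exact Hr0.
assert (Hh0 : h r0 <> 0) by (intros E; apply Hne; rewrite E; ring).
assert (Hwn : ~ (forall x y, w x = w y)) by (intros H; apply Hne; now rewrite (H t1 t2)).
assert (Hw0 : exists t0, w t0 <> 0).
  apply NNPP; intros H; apply Hwn.
  assert (H' : forall x, w x = 0) by (intros x; apply NNPP; intros Hx; apply H; now exists x).
  intros x y; now rewrite !H'.
destruct Hw0 as (t0 & Hw0).
destruct (product_derivatives a b _ u h w r0 t0 Hsol Hr0 Hu Hh0 Hw0) as [Dh Dw].
assert (Hsin : forall r, a < r < b -> 0 < sin r)
  by (intros r Hr; now apply (sin_pos_between a b)).
set (w2 := Derive (Derive w)).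
(* sin^2 r times the radial Laplacian of [h]; this multiplication leaves h w'' without a
   trigonometric weight. *)
set (L := fun r => sin r ^ 2 * Derive (Derive h) r + sin r * cos r * Derive h r).
assert (Hode : forall r t, a < r < b ->
    L r * w t + h r * w2 t = sin r ^ 2 * (eps * (signed_power q (h r) * signed_power q (w t)))).
  intros r t Hr; rewrite <- signed_power_mult, <- Hu by exact Hr.
  destruct Hsol as [_ Hsol]; rewrite <- (proj2 (Hsol r t Hr)).
  rewrite (laplace_beltrami_product a b u h (Derive h) w (Derive w)
    (Derive (Derive h) r) (Derive (Derive w) t)); auto.
  - unfold L, w2; specialize (Hsin r Hr); field; lra.
  - intros s Hs; now apply Derive_correct, Dh.
  - now apply Derive_correct, Dh.
  - intros s; now apply Derive_correct, Dw.
  - now apply Derive_correct, Dw.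
destruct (two_moduli w) as (x & y & Hx & Hxy); [|exact Hwn|].
  intros t; apply (is_derive_continuity_pt w t (Derive w t)); now apply Derive_correct, Dw.
(* linear independence makes both radial coefficients of the separated equation
   constant where [h] does not vanish *)
assert (Hconst : forall r, a < r < b -> h r <> 0 ->
    L r / h r = L r0 / h r0 /\
    sin r ^ 2 * Rpower (Rabs (h r)) (q - 1) = sin r0 ^ 2 * Rpower (Rabs (h r0)) (q - 1)).
  intros r Hr Hh.
  set (rho := fun t => Rpower (Rabs (w t)) (q - 1)).
  set (A := L r / h r - L r0 / h r0).
  set (B := sin r ^ 2 * Rpower (Rabs (h r)) (q - 1) - sin r0 ^ 2 * Rpower (Rabs (h r0)) (q - 1)).
  (* Dividing by [h] at [r] and at [r0] and subtracting eliminates w''; what remains, divided by w,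
     is constant in [t]. Two different values of [rho] then force B = 0, hence A = 0. *)
  assert (Hlin : forall t, w t <> 0 -> A = eps * B * rho t).
    intros t Ht.
    generalize (Hode r t Hr) (Hode r0 t Hr0); unfold signed_power; fold (rho t).
    set (P := Rpower (Rabs (h r)) (q - 1)); set (P0 := Rpower (Rabs (h r0)) (q - 1)).
    intros E E0.
    assert (Q : L r / h r * w t + w2 t = sin r ^ 2 * P * eps * w t * rho t).
      apply (Rmult_eq_reg_l (h r)); [|exact Hh].
      transitivity (L r * w t + h r * w2 t); [field; exact Hh|rewrite E; ring].
    assert (Q0 : L r0 / h r0 * w t + w2 t = sin r0 ^ 2 * P0 * eps * w t * rho t).
      apply (Rmult_eq_reg_l (h r0)); [|exact Hh0].
      transitivity (L r0 * w t + h r0 * w2 t); [field; exact Hh0|rewrite E0; ring].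
    apply (Rmult_eq_reg_r (w t)); [|exact Ht].
    unfold A, B; fold P P0; lra.
  assert (Hwx : w x <> 0) by (intros E; rewrite E, Rabs_R0 in Hx; lra).
  assert (Hwy : w y <> 0) by (intros E; rewrite E, Rabs_R0 in Hxy; lra).
  assert (Hrho : rho x <> rho y).
    intros E; apply Rpower_inj_base in E; [lra|lra|lra|lra].
  generalize (Hlin x Hwx) (Hlin y Hwy); intros Ex Ey.
  assert (HB : B = 0).
    assert (H0 : eps * B * (rho x - rho y) = 0) by lra.
    apply Rmult_integral in H0; destruct H0 as [H0|H0]; [|lra].
    apply Rmult_integral in H0; destruct H0; [contradiction|assumption].
  assert (HA : A = 0) by (rewrite Ex, HB; ring).
  unfold A in HA; unfold B in HB; lra.
set (p := 2 / (q - 1)).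
assert (Hq1 : q - 1 <> 0) by lra.
assert (Hp0 : p <> 0) by (unfold p; apply Rmult_integral_contrapositive_currified;
  [lra|now apply Rinv_neq_0_compat]).
(* The exponent [p] gives |g|^(q-1) = sin^2 |h|^(q-1). So [g] is 0 where [h] vanishes and has
   modulus |g r0| elsewhere; continuity makes it constant, and [h] turns out to have no zeros. *)
set (g := fun r => h r * Rpower (sin r) p).
assert (Hpow : forall r e, 0 < Rpower (sin r) e) by (intros; apply exp_pos).
assert (Hgabs : forall r, a < r < b -> h r <> 0 ->
    Rpower (Rabs (g r)) (q - 1) = sin r ^ 2 * Rpower (Rabs (h r)) (q - 1)).
  intros r Hr Hh; unfold g.
  rewrite Rabs_mult, (Rabs_right (Rpower _ _)) by (apply Rle_ge, Rlt_le, Hpow).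
  rewrite <- Rpower_mult_distr; [|now apply Rabs_pos_lt|apply Hpow].
  rewrite Rpower_mult; replace (p * (q - 1)) with (INR 2)
    by (unfold p; simpl; field; exact Hq1).
  rewrite Rpower_pow by now apply Hsin.
  ring.
assert (Hg0 : g r0 <> 0) by (unfold g; generalize (Hpow r0 p); intros; nra).
assert (Hg : forall r, a < r < b -> g r = g r0).
  intros r Hr; apply (two_valued_const a b g r0 r); auto.
  - intros s Hs; apply continuity_pt_mult.
    + apply (is_derive_continuity_pt h s (Derive h s)); now apply Derive_correct, Dh.
    + eapply is_derive_continuity_pt, sin_power_derive; now apply Hsin.
  - intros s Hs; destruct (Req_dec (h s) 0) as [Hz|Hz]; [left; unfold g; rewrite Hz; ring|right].
    assert (Hgs : g s <> 0) by (unfold g; generalize (Hpow s p); intros; nra).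
    apply (Rpower_inj_base _ _ (q - 1)); try (now apply Rabs_pos_lt); auto.
    rewrite !Hgabs by auto; now apply Hconst.
assert (Hh : forall r, a < r < b -> h r = g r0 * Rpower (sin r) (- p)).
  intros r Hr; rewrite <- (Hg r Hr); unfold g; rewrite Rpower_Ropp.
  field; apply Rgt_not_eq, Hpow.
assert (Hh' : forall r, a < r < b -> h r <> 0).
  intros r Hr; rewrite Hh by exact Hr; generalize (Hpow r (- p)); intros; nra.
assert (Dh1 : forall r, a < r < b -> Derive h r = - p * (cos r / sin r) * h r).
  intros r Hr; apply is_derive_unique.
  apply is_derive_ext_loc with (fun s => g r0 * Rpower (sin s) (- p)).
  - generalize (locally_between a b r Hr); apply filter_imp; intros s Hs; now rewrite Hh.
  - evar_last; [apply is_derive_scal, sin_power_derive; now apply Hsin|].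
    rewrite (Hh r) by exact Hr; ring.
assert (HL : forall r, a < r < b -> L r / h r = (p ^ 2 - p) * cos r ^ 2 + p).
  intros r Hr; generalize (Hsin r Hr) (Hh' r Hr); intros Hs Hhr.
  assert (E : Derive (Derive h) r = p / sin r ^ 2 * h r + p ^ 2 * (cos r / sin r) ^ 2 * h r).
    apply is_derive_unique.
    apply is_derive_ext_loc with (fun s => - p * (cos s / sin s) * h s).
    - generalize (locally_between a b r Hr); apply filter_imp; intros s Hs'; now rewrite Dh1.
    - evar_last.
      + apply (is_derive_mult (fun s => - p * (cos s / sin s)) h);
          [|apply Derive_correct, Dh, Hr|intros; apply Rmult_comm].
        auto_derive; [lra|reflexivity].
      + rewrite Dh1 by exact Hr; unfold plus, mult; simpl.
        replace (1 * - sin r * / sin r + cos r * (- (1 * cos r) * / (sin r * sin r)))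
          with (- ((sin r * sin r + cos r * cos r) / sin r ^ 2)) by (field; lra).
        generalize (sin2_cos2 r); unfold Rsqr; intros ->; field; lra.
  unfold L; rewrite E, Dh1 by exact Hr.
  field; lra.
assert (Hp1 : p = 1).
  assert (H : p ^ 2 - p = 0).
    apply (cos_sqr_not_const a b _ p Ha Hab Hb); intros r s Hr Hs.
    rewrite <- !HL by assumption.
    transitivity (L r0 / h r0); [|symmetry]; apply Hconst; auto.
  apply (Rmult_eq_reg_l p); [lra|exact Hp0].
assert (Hq3 : q = 3).
  assert (H : p * (q - 1) = 2) by (unfold p; field; exact Hq1).
  rewrite Hp1 in H; lra.
split; [exact Hq3|].
assert (Hhs : forall r, a < r < b -> h r = g r0 / sin r).
  intros r Hr; rewrite Hh, Hp1, Rpower_Ropp, Rpower_1 by auto; reflexivity.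
assert (Hode' : forall t, w2 t = eps * g r0 ^ 2 * w t ^ 3 - w t).
  intros t; generalize (Hode r0 t Hr0) (HL r0 Hr0); rewrite Hq3, !signed_power_3, Hp1.
  intros E1 E2.
  assert (E3 : L r0 = h r0).
    transitivity (L r0 / h r0 * h r0); [field; exact Hh0|rewrite E2; ring].
  rewrite E3 in E1.
  replace (g r0) with (sin r0 * h r0) by (rewrite Hhs by exact Hr0; field; specialize (Hsin r0 Hr0); lra).
  apply (Rmult_eq_reg_l (h r0)); [|exact Hh0].
  transitivity (h r0 * w t + h r0 * w2 t - h r0 * w t); [ring|rewrite E1; ring].
exists (fun x => g r0 * w x), (fun x => g r0 * Derive w x); split; [|split; [|split; [|split]]].
- intros t; apply is_derive_scal; now apply Derive_correct, Dw.
- intros t; evar_last; [apply is_derive_scal, Derive_correct, Dw|].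
  fold w2; rewrite Hode'; ring.
- intros t; now rewrite Hper.
- intros H; apply Hwn; intros s t; apply (Rmult_eq_reg_l (g r0)); [apply H|exact Hg0].
- intros r t Hr; rewrite Hu, Hhs by exact Hr; specialize (Hsin r Hr); field; lra.
Qed.

(** * From angular profiles back to C^2 solutions *)

Lemma continuity_2d_pt_product (f g : R -> R) (x y : R) :
  continuity_pt f x -> continuity_pt g y -> continuity_2d_pt (fun u v => f u * g v) x y.
Proof.
intros Hf Hg; apply continuity_2d_pt_mult.
- apply (continuity_1d_2d_pt_comp f (fun u _ => u)); [exact Hf|apply continuity_2d_pt_id1].
- apply (continuity_1d_2d_pt_comp g (fun _ v => v)); [exact Hg|apply continuity_2d_pt_id2].
Qed.

Lemma inv_sin_derive (r : R) : 0 < sin r ->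
  is_derive (fun s => / sin s) r (- cos r / sin r ^ 2).
Proof. intros Hs; auto_derive; [lra|field; lra]. Qed.

Lemma inv_sin_derive2 (r : R) : 0 < sin r ->
  is_derive (fun s => - cos s / sin s ^ 2) r (/ sin r + 2 * cos r ^ 2 / sin r ^ 3).
Proof.
intros Hs; auto_derive.
- simpl; generalize (Rmult_lt_0_compat _ _ Hs Hs); lra.
- replace (/ sin r) with (sin r ^ 2 / sin r ^ 3) by (field; lra); simpl; field; lra.
Qed.

Lemma ex_diff_n_product_1 (a b : R) (f f1 g g1 : R -> R) (r t : R) :
  a < r < b -> (forall s, a < s < b -> is_derive f s (f1 s)) ->
  (forall v, is_derive g v (g1 v)) -> continuity_pt f1 r -> continuity_pt g1 t ->
  ex_diff_n (fun s v => f s * g v) 1 r t.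
Proof.
intros Hr Hf Hg Cf1 Cg1.
assert (Cf : continuity_pt f r) by (eapply is_derive_continuity_pt, Hf, Hr).
assert (Cg : continuity_pt g t) by (eapply is_derive_continuity_pt, Hg).
destruct (locally_between a b r Hr) as [d Hd].
split; [|split; [|split; [|split; split; trivial]]].
- now apply continuity_2d_pt_product.
- apply ex_derive_mult; [now exists (f1 r); apply Hf|apply ex_derive_const].
- apply ex_derive_mult; [apply ex_derive_const|now exists (g1 t)].
- apply continuity_2d_pt_ext_loc with (fun s v => f1 s * g v);
    [|now apply continuity_2d_pt_product].
  exists d; intros s v Hs _; symmetry.
  apply is_derive_unique, (is_derive_scal_l (V := R_NormedModule)), Hf, Hd, Hs.
- apply continuity_2d_pt_ext with (fun s v => f s * g1 v);
    [|now apply continuity_2d_pt_product].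
  intros s v; symmetry; apply is_derive_unique, is_derive_scal, Hg.
Qed.

(** Partial derivatives of a product are again products, so order 2 reduces to order 1 for the pairs
    (f1, g) and (f, g1). In r the identification holds only inside ]a, b[, hence the local
    extensionality. *)
Lemma ex_diff_n_product_2 (a b : R) (f f1 f2 g g1 g2 : R -> R) (r t : R) :
  a < r < b -> (forall s, a < s < b -> is_derive f s (f1 s)) ->
  (forall s, a < s < b -> is_derive f1 s (f2 s)) ->
  (forall v, is_derive g v (g1 v)) -> (forall v, is_derive g1 v (g2 v)) ->
  continuity_pt f2 r -> continuity_pt g2 t ->
  ex_diff_n (fun s v => f s * g v) 2 r t.
Proof.
intros Hr Hf Hf1 Hg Hg1 Cf2 Cg2.
assert (Cf1 : continuity_pt f1 r) by (eapply is_derive_continuity_pt, Hf1, Hr).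
assert (Cg1 : continuity_pt g1 t) by (eapply is_derive_continuity_pt, Hg1).
destruct (ex_diff_n_product_1 a b f f1 g g1 r t Hr Hf Hg Cf1 Cg1) as (H0 & H1 & H2 & _).
destruct (locally_between a b r Hr) as [d Hd].
split; [exact H0|split; [exact H1|split; [exact H2|split]]].
- apply ex_diff_n_ext_loc with (fun s v => f1 s * g v);
    [|now apply (ex_diff_n_product_1 a b f1 f2 g g1)].
  exists d; intros s v Hs _; symmetry.
  apply is_derive_unique, (is_derive_scal_l (V := R_NormedModule)), Hf, Hd, Hs.
- apply ex_diff_n_ext_loc with (fun s v => f s * g1 v);
    [|now apply (ex_diff_n_product_1 a b f f1 g1 g2)].
  exists d; intros s v _ _; symmetry; apply is_derive_unique, is_derive_scal, Hg.
Qed.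

(** For h = 1 / sin r one has h'' + (cos r / sin r) h' = 1 / sin^3 r. Thus w and w'' both receive
    the weight 1 / sin^3 r, which is also that of u^3. *)
Lemma profile_solution (a b : R) (w : R -> R) (u : R -> R -> R) :
  0 <= a -> b <= PI -> ode_solution w -> periodic (2 * PI) w ->
  (forall r t, a < r < b -> u r t = w t / sin r) ->
  classical_solution a b (fun s => - s ^ 3) u /\ pseudo_radial a b u.
Proof.
intros Ha Hb Hw Hper Hu.
assert (Hsin : forall r, a < r < b -> 0 < sin r)
  by (intros r Hr; now apply (sin_pos_between a b)).
assert (Hu' : forall r t, a < r < b -> u r t = / sin r * w t)
  by (intros r t Hr; rewrite Hu by exact Hr; apply Rmult_comm).
set (h1 := fun s => - cos s / sin s ^ 2).
set (h2 := fun s => / sin s + 2 * cos s ^ 2 / sin s ^ 3).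
split; [split|exists (fun r => / sin r), w; now split].
- intros r Hr t; rewrite !Hu, Hper by exact Hr; reflexivity.
- intros r t Hr; split.
  + apply ex_diff_n_ext_loc with (fun s v => / sin s * w v).
      destruct (locally_between a b r Hr) as [d Hd]; exists d.
      intros s v Hs _; symmetry; apply Hu', Hd, Hs.
    apply (ex_diff_n_product_2 a b _ h1 h2 w (Derive w) (fun v => - w v - w v ^ 3)); auto.
    * intros s Hs; apply inv_sin_derive; auto.
    * intros s Hs; apply inv_sin_derive2; auto.
    * intros v; now apply ode_solution_derive.
    * intros v; now apply ode_solution_derive2.
    * generalize (Hsin r Hr); intros Hs.
      apply continuity_pt_filterlim, (ex_derive_continuous (V := R_NormedModule)).
      unfold h2; auto_derive; repeat split; try lra.
      simpl; apply Rgt_not_eq; repeat apply Rmult_lt_0_compat; lra.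
    * apply continuity_pt_filterlim,
        (ex_derive_continuous (V := R_NormedModule) (fun v => - w v - w v ^ 3)).
      auto_derive; destruct (Hw t) as [H _]; tauto.
  + rewrite (laplace_beltrami_product a b u (fun s => / sin s) h1 w (Derive w)
      (h2 r) (- w t - w t ^ 3)); auto.
    * rewrite Hu by exact Hr; unfold h1, h2; generalize (Hsin r Hr); intros Hs.
      transitivity (((sin r * sin r + cos r * cos r - 1) * w t - w t ^ 3) / sin r ^ 3);
        [field; lra|].
      generalize (sin2_cos2 r); unfold Rsqr; intros ->; field; lra.
    * intros s Hs; apply inv_sin_derive; auto.
    * apply inv_sin_derive2; auto.
    * intros s; now apply ode_solution_derive.
    * now apply ode_solution_derive2.
Qed.

(** * The profiles indexed by their least period *)

Lemma period_index_bounds (k : nat) : (2 <= k)%nat -> 0 < 2 * PI / INR k < 2 * PI.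
Proof.
intros Hk; generalize PI_RGT_0; intros Hpi.
assert (H : 2 <= INR k) by (replace 2 with (INR 2) by (simpl; ring); now apply le_INR).
split; [apply Rdiv_lt_0_compat; lra|apply Rlt_div_l; [lra|nra]].
Qed.

Lemma least_period_not_const (T : R) (f : R -> R) :
  least_period T f -> ~ (forall x y, f x = f y).
Proof.
intros (HT & _ & HL) Hc.
assert (T <= T / 2); [apply HL; [lra|intros x; apply Hc]|lra].
Qed.

(** The least period of a nonconstant 2 PI-periodic solution divides 2 PI and is smaller than 2 PI,
    so it is 2 PI / k with k >= 2. Injectivity of [period] then gives it the same energy as
    [w k]. *)
Lemma angular_profiles_exist : exists w : nat -> R -> R,
  (forall k, (2 <= k)%nat -> angular_profile k (w k)) /\
  (forall f, ode_solution f -> ~ (forall x y, f x = f y) -> periodic (2 * PI) f ->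
     exists k t, (2 <= k)%nat /\ least_period (2 * PI / INR k) f /\
       forall x, f x = w k (x + t)).
Proof.
(* The choice principle wants a value at every index; those below 2 receive a dummy. *)
assert (Hm : forall k : nat, exists m, (2 <= k)%nat -> 0 < m /\ period m = 2 * PI / INR k).
  intros k; destruct (le_lt_dec 2 k) as [Hk|Hk].
  - destruct (period_surjective _ (period_index_bounds k Hk)) as [m Hm]; now exists m.
  - exists 0; lia.
destruct (functional_choice _ Hm) as [m Em].
assert (Hw : forall k : nat, exists w : R -> R, (2 <= k)%nat ->
    ode_solution w /\ least_period (period (m k)) w /\
    forall c0 c1, c1 ^ 2 + c0 ^ 2 + c0 ^ 4 / 2 = 2 * m k + 2 * m k ^ 2 ->
      exists t, w t = c0 /\ Derive w t = c1).
  intros k; destruct (le_lt_dec 2 k) as [Hk|Hk].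
  - destruct (orbit_exists (m k)) as [w Hw]; [now apply Em|now exists w].
  - exists (fun _ => 0); lia.
destruct (functional_choice _ Hw) as [w Ew]; exists w; split.
- intros k Hk; destruct (Ew k Hk) as (H1 & H2 & _); destruct (Em k Hk) as [_ E].
  split; [exact H1|split].
  + now apply least_period_not_const with (period (m k)).
  + now rewrite <- E.
- intros f Hf Hn Hp; generalize PI_RGT_0; intros Hpi.
  destruct (ode_solution_orbit f Hf Hn) as (n & Hn0 & Horb).
  destruct (orbit_exists n Hn0) as (v & Hv1 & Hv2 & Hv3).
  destruct (Horb v Hv1 Hv3) as [t Ht].
  assert (HL : least_period (period n) f).
    destruct (least_period_shift _ t _ Hv2) as (L1 & L2 & L3); split; [exact L1|split].
    - intros x; rewrite !Ht; apply L2.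
    - intros T' HT' PT'; apply L3; [exact HT'|]; intros x; rewrite <- !Ht; apply PT'.
  destruct (least_period_divides _ (2 * PI) f HL) as (k & Hk & Ek); [lra|exact Hp|].
  generalize (period_lt_2PI n Hn0) (period_pos n ltac:(lra)); intros Hlt Hpos.
  assert (Hk2 : (2 <= k)%nat).
    destruct k as [|[|k]]; [lia|simpl in Ek; lra|lia].
  assert (Hk0 : 0 < INR k) by (apply lt_0_INR; lia).
  assert (En : period n = 2 * PI / INR k) by (rewrite Ek; field; lra).
  destruct (Em k Hk2) as [Hmk Emk].
  assert (Enm : n = m k) by (apply period_injective; auto; congruence).
  destruct (Ew k Hk2) as (W1 & _ & W3).
  destruct (Horb (w k) W1) as [t' Ht']; [now rewrite Enm|].
  exists k, t'; split; [exact Hk2|split; [now rewrite <- En|exact Ht']].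
Qed.

Lemma angular_profile_index (k l : nat) (f : R -> R) :
  (2 <= k)%nat -> (2 <= l)%nat ->
  least_period (2 * PI / INR k) f -> least_period (2 * PI / INR l) f -> k = l.
Proof.
intros Hk Hl Pk Pl; generalize PI_RGT_0; intros Hpi.
assert (H0 : forall n : nat, (2 <= n)%nat -> 0 < INR n) by (intros n Hn; apply lt_0_INR; lia).
generalize (H0 k Hk) (H0 l Hl); intros H1 H2.
apply INR_eq, Rinv_eq_reg.
apply (Rmult_eq_reg_l (2 * PI)); [|lra].
exact (least_period_unique _ _ f Pk Pl).
Qed.

Lemma angular_profile_2PI (k : nat) (f : R -> R) :
  (2 <= k)%nat -> angular_profile k f -> periodic (2 * PI) f.
Proof.
intros Hk (_ & _ & _ & H & _).
replace (2 * PI) with (INR k * (2 * PI / INR k)); [now apply periodic_nat|].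
field; apply not_0_INR; lia.
Qed.

Lemma ode_solution_sign (s : R) (f : R -> R) :
  is_sign s -> ode_solution f -> ode_solution (fun x => s * f x).
Proof.
intros Hs Hf; apply ode_solution_intro with (fun x => s * Derive f x); intros x.
- apply is_derive_scal, ode_solution_derive, Hf.
- evar_last; [apply is_derive_scal, ode_solution_derive2, Hf|].
  destruct Hs as [-> | ->]; simpl; ring.
Qed.

Lemma profile_not_radial (a b : R) (w : R -> R) (u : R -> R -> R) :
  0 <= a -> a < b -> b <= PI -> ~ (forall x y, w x = w y) ->
  (forall r t, a < r < b -> u r t = w t / sin r) -> ~ radial a b u.
Proof.
intros Ha Hab Hb Hn Hu Hr; apply Hn; intros x y.
assert (Hm : a < (a + b) / 2 < b) by lra.
generalize (Hr _ x y Hm) (sin_pos_between a b _ Ha Hb Hm); rewrite !Hu by exact Hm.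
intros E Hs; apply (Rmult_eq_reg_r (/ sin ((a + b) / 2))); [exact E|].
apply Rinv_neq_0_compat; lra.
Qed.

Lemma classical_solution_ext (a b : R) (F G : R -> R) (u : R -> R -> R) :
  (forall s, F s = G s) -> classical_solution a b F u -> classical_solution a b G u.
Proof.
intros E [H1 H2]; split; [exact H1|]; intros r t Hr; rewrite <- E; now apply H2.
Qed.

Theorem theorem6 (a b : R) (ha : 0 <= a) (hab : a < b) (hb : b <= PI) :
  (forall eps q : R, is_sign eps -> 0 < q -> q <> 1 ->
     eps = 1 \/ q <> 3 ->
     forall u : R -> R -> R,
       classical_solution a b (fun s => eps * signed_power q s) u ->
       pseudo_radial a b u -> radial a b u)
  /\
  ((exists v : nat -> R -> R -> R,
      (forall n : nat,
         classical_solution a b (fun s => - s ^ 3) (v n) /\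
         pseudo_radial a b (v n) /\ ~ radial a b (v n)) /\
      (forall m n : nat, m <> n -> ~ rotation_of a b (v m) (v n)))
   /\
   (exists w : nat -> R -> R,
      (forall k : nat, (2 <= k)%nat ->
         angular_profile k (w k) /\
         forall f : R -> R, angular_profile k f ->
           exists s t : R, is_sign s /\ forall x, f x = s * w k (x + t)) /\
      (forall u : R -> R -> R,
         (classical_solution a b (fun s => - s ^ 3) u /\
          pseudo_radial a b u /\ ~ radial a b u)
         <->
         exists (k : nat) (s t : R), (2 <= k)%nat /\ is_sign s /\
           forall r theta, a < r < b ->
             u r theta = s * (w k (theta + t) / sin r)))).
Proof.
split.
- intros eps q Heps Hq Hq1 Hcase u Hsol Hpr; apply NNPP; intros Hnr.
  destruct (pseudo_radial_profile a b eps q u) as (Hq3 & W & W1 & D1 & D2 & Hper & Hn & _); auto.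
    destruct Heps; lra.
  destruct Hcase as [H|H]; [|contradiction].
  apply Hn, (soft_periodic_const W W1); [|exact Hper].
  split; [exact D1|]; intros x; replace (W x ^ 3 - W x) with (eps * W x ^ 3 - W x)
    by (rewrite H; ring); apply D2.
- destruct angular_profiles_exist as (w & Hw & Huniq).
  assert (Hsol : forall (k : nat) (s t : R) (u : R -> R -> R), (2 <= k)%nat -> is_sign s ->
      (forall r theta, a < r < b -> u r theta = s * (w k (theta + t) / sin r)) ->
      classical_solution a b (fun s => - s ^ 3) u /\ pseudo_radial a b u /\ ~ radial a b u).
    intros k s t u Hk Hs Hu; generalize (Hw k Hk); intros (O & N & L).
    assert (Hs0 : s <> 0) by (destruct Hs; lra).
    assert (P2 : periodic (2 * PI) (w k)) by now apply (angular_profile_2PI k), Hw.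
    set (f := fun x => s * w k (x + t)).
    assert (Hu' : forall r theta, a < r < b -> u r theta = f theta / sin r).
      intros r theta Hr; rewrite Hu by exact Hr; unfold f, Rdiv; ring.
    rewrite <- and_assoc; split.
    + apply (profile_solution a b f); auto.
      * apply ode_solution_sign, ode_solution_shift; assumption.
      * intros x; unfold f; rewrite <- (P2 (x + t)); do 2 f_equal; ring.
    + apply (profile_not_radial a b f); auto.
      intros Hc; apply N; intros x y; apply (Rmult_eq_reg_l s); [|exact Hs0].
      generalize (Hc (x - t) (y - t)); unfold f.
      now replace (x - t + t) with x by ring; replace (y - t + t) with y by ring.
  assert (Hone : is_sign 1) by now left.
  split.
  (* The shift by 2 starts the sequence at k = 2; the factor 1 and the angle 0 put it in the form
     that [Hsol] expects. *)
  + exists (fun n r theta => 1 * (w (n + 2)%nat (theta + 0) / sin r)); split.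
    * intros n; apply (Hsol (n + 2)%nat 1 0); auto; lia.
    * intros m n Hmn [t Ht]; apply Hmn.
      set (r := (a + b) / 2); assert (Hr : a < r < b) by (unfold r; lra).
      generalize (sin_pos_between a b r ha hb Hr); intros Hs.
      (* On a single parallel, the rotation becomes a translation between the profiles, which must
         then share their least period and hence their index. *)
      assert (E : forall x, w (n + 2)%nat x = w (m + 2)%nat (x + t)).
        intros x; generalize (Ht r x Hr); rewrite !Rplus_0_r, !Rmult_1_l; intros E.
        apply (Rmult_eq_reg_r (/ sin r)); [exact E|apply Rinv_neq_0_compat; lra].
      assert (Hm2 : (2 <= m + 2)%nat) by lia; assert (Hn2 : (2 <= n + 2)%nat) by lia.
      destruct (Hw _ Hm2) as (_ & _ & Lm); destruct (Hw _ Hn2) as (_ & _ & Ln).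
      assert (m + 2 = n + 2)%nat; [|lia].
      apply (angular_profile_index _ _ (fun x => w (m + 2)%nat (x + t))); auto.
      -- now apply least_period_shift.
      -- destruct Ln as (L1 & L2 & L3); split; [exact L1|split].
         ++ intros x; rewrite <- !E; apply L2.
         ++ intros T' HT' PT'; apply L3; [exact HT'|]; intros x; rewrite !E; apply PT'.
  + exists w; split.
    * intros k Hk; split; [now apply Hw|]; intros f Hf.
      destruct (Huniq f) as (l & t & Hl & Pl & E); try apply Hf.
        now apply (angular_profile_2PI k).
      assert (l = k) as -> by (apply (angular_profile_index l k f); auto; apply Hf).
      (* The sign is always 1: the opposite of a profile lies on the same energy level, so it is
         already among the translates. *)
      exists 1, t; split; [exact Hone|]; intros x; rewrite E; ring.
    * intros u; split; [|intros (k & s & t & Hk & Hs & Hu); now apply (Hsol k s t)].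
      intros (Hcs & Hpr & Hnr).
      destruct (pseudo_radial_profile a b (-1) 3 u) as (_ & W & W1 & D1 & D2 & Hper & Hn & Hu);
        auto; try lra.
        apply classical_solution_ext with (2 := Hcs); intros s; rewrite signed_power_3; ring.
      destruct (Huniq W) as (k & t & Hk & _ & E); auto.
        apply ode_solution_intro with W1; [exact D1|]; intros x.
        replace (- W x - W x ^ 3) with (-1 * W x ^ 3 - W x) by ring; apply D2.
      exists k, 1, t; split; [exact Hk|split; [exact Hone|]].
      intros r theta Hr; rewrite Hu, E by exact Hr; ring.
Qed.
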